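(* Let $n\ge 2$ and $k\in\{2,\dots,n\}$. Let $d,e\in\{1,\dots,k-1\}$ be such that $d+e\le k$, and let $j\in\{1,\dots,\min(d,e)\}$. Let $A$ be a linear subspace of $\mathbb{R}^n$ of dimension $d$ such that there exists a rational subspace $F\in\mathfrak{R}_n(k)$ with $A\subset F$. Let $\varphi$ be a rational isomorphism from $F$ onto $\mathbb{R}^k$ and let $\tilde A=\varphi(A)$, a $d$-dimensional subspace of $\mathbb{R}^k$. Suppose that for every rational subspace $B'$ of $F$ of dimension $e$ one has $$\dim(A\cap B')<j.$$ Then $A\in\mathfrak{I}_n(d,e)_j$, $\tilde A\in\mathfrak{I}_k(d,e)_j$, and $$\mu_n(A\mid e)_j=\mu_k(\tilde A\mid e)_j.$$
   Context: $\mathbb{R}^n$ and $\Lambda^2(\mathbb{R}^n)$ carry their canonical Euclidean norms. **Rational subspaces.** A linear subspace $B$ of $\mathbb{R}^n$ is rational if it has a basis of vectors with rational coordinates; $\mathfrak{R}_n(e)$ is the set of rational subspaces of $\mathbb{R}^n$ of dimension $e$. A linear isomorphism $\varphi:F\to\mathbb{R}^k$ from a rational subspace $F$ is rational if it maps vectors of $F$ with rational coordinates to vectors with rational coordinates. **Height.** For $B\in\mathfrak{R}_n(e)$, the Plücker coordinates of $B$ are the $\binom{n}{e}$ minors of size $e\times e$ of an $n\times e$ matrix whose columns form a basis of $B$ (well defined up to a nonzero scalar); choosing a representative $\Xi$ with integer coordinates with gcd $1$, set $H(B)=\|\Xi\|$ (Euclidean norm). **Angles.** For nonzero $X,Y\in\mathbb{R}^n$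 let $\psi(X,Y)=\|X\wedge Y\|/(\|X\|\,\|Y\|)$ (sine of the angle). For subspaces $A,B$ of dimensions $d,e\ge 1$ and $t=\min(d,e)$, define $\psi_1(A,B),\dots,\psi_t(A,B)$ recursively: $\psi_1(A,B)=\min\psi(X,Y)$ over $X\in A\setminus\{0\}$, $Y\in B\setminus\{0\}$, attained at unit vectors $X_1,Y_1$; given $(X_1,Y_1),\dots,(X_j,Y_j)$, $\psi_{j+1}(A,B)=\min\psi(X,Y)$ over nonzero $X\in A$ orthogonal to $X_1,\dots,X_j$ and nonzero $Y\in B$ orthogonal to $Y_1,\dots,Y_j$, attained at unit vectors $X_{j+1},Y_{j+1}$. (These numbers do not depend on the choices.) **Irrationality and exponents.** Let $d,e\in\{1,\dots,n-1\}$ with $d+e\le n$ and $1\le j\le\min(d,e)$. $\mathfrak{I}_n(d,e)_j$ is the set of $d$-dimensional subspaces $A$ of $\mathbb{R}^n$ with $\dim(A\cap B)<j$ for all $B\in\mathfrak{R}_n(e)$. For $A\in\mathfrak{I}_n(d,e)_j$, $\mu_n(A\mid e)_j\in(0,+\infty]$ is the supremum of the $\beta>0$ such that $\psi_j(A,B)\le H(B)^{-\beta}$ for infinitely many $B\in\mathfrak{R}_n(e)$. *)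

(* Defs.v *)
(* R^n is 'rV[R]_n, for an arbitrary R : realType. *)
From HB Require Import structures.
From mathcomp Require Import all_boot all_order all_algebra.
From mathcomp Require Import all_classical all_reals all_analysis.

Set Implicit Arguments.
Unset Strict Implicit.
Unset Printing Implicit Defensive.

Import Order.TTheory GRing.Theory Num.Theory.
Local Open Scope classical_set_scope.
Local Open Scope ring_scope.

(* The library norm `|x| on 'rV[R]_n is the sup norm, hence the explicit
   Euclidean structure here. *)
Definition dotv (R : realType) (n : nat) (x y : 'rV[R]_n) : R :=
  \sum_(i < n) x 0 i * y 0 i.

Definition enorm (R : realType) (n : nat) (x : 'rV[R]_n) : R :=
  Num.sqrt (\sum_(i < n) x 0 i ^+ 2).

(* || x /\ y ||, the coordinates of x /\ y being taken in the orthonormal basis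
   (e_i /\ e_j)_(i < j) of the second exterior power. *)
Definition wedge_norm (R : realType) (n : nat) (x y : 'rV[R]_n) : R :=
  Num.sqrt (\sum_(i < n) \sum_(j < n | (i < j)%N)
              (x 0 i * y 0 j - x 0 j * y 0 i) ^+ 2).

Definition psi (R : realType) (n : nat) (x y : 'rV[R]_n) : R :=
  wedge_norm x y / (enorm x * enorm y).

Definition rational_vec (R : realType) (n : nat) (x : 'rV[R]_n) : Prop :=
  forall i, exists q : rat, x 0 i = ratr q.

Definition rational_sub (R : realType) (n : nat) (B : {vspace 'rV[R]_n}) : Prop :=
  exists2 X : seq 'rV[R]_n, basis_of B X & forall x, x \in X -> rational_vec x.

Definition rational_subs (R : realType) (n e : nat) : set {vspace 'rV[R]_n} :=
  [set B | rational_sub B /\ \dim B = e].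

(* A linear map defined on F only is a linear map on the subtype subvs_of F. *)
Definition rational_iso (R : realType) (n k : nat) (F : {vspace 'rV[R]_n})
    (phi : 'Hom(subvs_of F, 'rV[R]_k)) : Prop :=
  bijective phi /\
  forall v : subvs_of F, rational_vec (vsval v) -> rational_vec (phi v).

(* phi(A) for A contained in F: A is first pulled back to subvs_of F. *)
Definition iso_image (R : realType) (n k : nat) (F : {vspace 'rV[R]_n})
    (phi : 'Hom(subvs_of F, 'rV[R]_k)) (A : {vspace 'rV[R]_n}) :
    {vspace 'rV[R]_k} :=
  (phi @: (linfun (vsval : subvs_of F -> 'rV[R]_n) @^-1: A))%VS.

(* The e x e minors of an n x e matrix are indexed by the strictly increasing
   maps 'I_e -> 'I_n, listing the selected rows. *)
Definition increasing (e n : nat) (f : {ffun 'I_e -> 'I_n}) : bool :=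
  [forall i : 'I_e, forall j : 'I_e, (i < j)%N ==> (f i < f j)%N].

(* Minor on the rows f of the matrix whose columns are the vectors of X. *)
Definition plucker (R : realType) (n e : nat) (X : e.-tuple 'rV[R]_n)
    (f : {ffun 'I_e -> 'I_n}) : R :=
  \det (\matrix_(i < e, j < e) (tnth X j) 0 (f i)).

(* Xi represents the Pluecker coordinates of B by coprime integers; only its
   values on increasing maps are relevant. *)
Definition primitive_plucker (R : realType) (n : nat) (B : {vspace 'rV[R]_n})
    (Xi : {ffun 'I_(\dim B) -> 'I_n} -> int) : Prop :=
  \big[gcdn/0%N]_(f | increasing f) `|Xi f|%N = 1%N /\
  exists (X : (\dim B).-tuple 'rV[R]_n) (c : R),
    [/\ basis_of B X, c != 0 &
        forall f, increasing f -> (Xi f)%:~R = c * plucker X f].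

(* The representative Xi is unique up to sign, so its norm does not depend on
   the choice. The default value 0 is taken only when B is not rational. *)
Definition height (R : realType) (n : nat) (B : {vspace 'rV[R]_n}) : R :=
  xget 0 [set h | exists2 Xi, primitive_plucker (B := B) Xi &
                  h = Num.sqrt (\sum_(f | increasing f) (Xi f)%:~R ^+ 2)].

(* Nonzero vectors x of A, y of B, orthogonal to the first (resp. second)
   components of the pairs in s. *)
Definition admissible (R : realType) (n : nat) (A B : {vspace 'rV[R]_n})
    (s : seq ('rV[R]_n * 'rV[R]_n)) : set ('rV[R]_n * 'rV[R]_n) :=
  [set p | [/\ p.1 \in A, p.1 != 0, p.2 \in B, p.2 != 0 &
     forall q, q \in s -> dotv p.1 q.1 = 0 /\ dotv p.2 q.2 = 0]].

Definition minimizing (R : realType) (n : nat) (A B : {vspace 'rV[R]_n})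
    (s : seq ('rV[R]_n * 'rV[R]_n)) : set ('rV[R]_n * 'rV[R]_n) :=
  [set p | [/\ admissible A B s p, enorm p.1 = 1, enorm p.2 = 1 &
     forall q, admissible A B s q -> psi p.1 p.2 <= psi q.1 q.2]].

(* A choice of (X_1, Y_1), ..., (X_j, Y_j), latest pair first. A minimizing
   pair exists as long as j <= min (dim A) (dim B). *)
Fixpoint principal_pairs (R : realType) (n : nat) (A B : {vspace 'rV[R]_n})
    (j : nat) : seq ('rV[R]_n * 'rV[R]_n) :=
  if j is j'.+1 then
    let s := principal_pairs A B j' in xget (0, 0) (minimizing A B s) :: s
  else [::].

(* psi_j(A, B), for 1 <= j <= min (dim A) (dim B). *)
Definition psi_idx (R : realType) (n : nat) (j : nat) (A B : {vspace 'rV[R]_n}) : R :=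
  let p := head (0, 0) (principal_pairs A B j) in psi p.1 p.2.

Definition irrational_subs (R : realType) (n d e j : nat) :
    set {vspace 'rV[R]_n} :=
  [set A | \dim A = d /\
     forall B : {vspace 'rV[R]_n}, rational_subs e B -> (\dim (A :&: B) < j)%N].

Definition mu_exp (R : realType) (n : nat) (A : {vspace 'rV[R]_n}) (e j : nat) :
    \bar R :=
  ereal_sup [set b%:E | b in [set b : R | 0 < b /\
    infinite_set [set B : {vspace 'rV[R]_n} | rational_subs e B /\
                          psi_idx j A B <= height B `^ (- b)]]].

(* Main.v *)
Require Import Defs.
From HB Require Import structures.
From mathcomp Require Import all_boot all_order all_algebra perm.
From mathcomp Require Import all_classical all_reals all_analysis.
From mathcomp Require Import ring lra.

Set Implicit Arguments.
Unset Strict Implicit.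
Unset Printing Implicit Defensive.

Import Order.TTheory GRing.Theory Num.Theory.
Import numFieldNormedType.Exports.
Local Open Scope classical_set_scope.
Local Open Scope ring_scope.

(**
Let [F] be the rational subspace containing [A]. In rational coordinates, [phi] is the
restriction to [F] of [x |-> x *m M0], and its inverse is [u |-> u *m N0], with rational
matrices such that [N0 *m M0 = 1] and [x *m M0 *m N0 = x] on [F] (rational_extension).
The theorem reduces to moving good rational approximations of [A] to good ones of [phi
A], and back, by rational linear maps.

Let [M] be rational, injective on [B], and inverted on [A] by some [N]. Then the image
of [B] has height at most a constant times that of [B] (height_img), because minors of
[X *m M] are fixed linear combinations of minors of [X]; and the angles satisfy [psi_j
(A M) (B M) <= C * psi_j A B] (psi_idx_img). The latter follows from a variational
description of [psi_j] up to a factor [j]: [psi_j A B] is comparable to the least [c]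
such that some subspace [U] of [B] of dimension [j] is within relative distance [c] of
[A] (psi_idx_close, psi_idx_le). The recursive definition gives it because in a
minimizing pair [(X_i, Y_i)] the vector [X_i] is orthogonal to every vector of [B]
orthogonal to [Y_1, ..., Y_i] (minimizing_orth).

Only finitely many subspaces have bounded height (finite_height_le), so along an
infinite family of approximations heights tend to infinity and constants are absorbed by
an arbitrarily small loss in the exponent; since the target is irrational, infinitely
many approximations have infinitely many images (approximations_transfer). Hence [mu_exp
A e j <= mu_exp A' e j] as soon as finitely many maps [M], all sending [A] to [A'], are
such that each rational [B] of dimension [e] admits one injective on it (mu_exp_le).

From R^k to R^n the single map [N0] is injective. From R^n to R^k, [M0] need not be
injective on [B], as [B] need not be contained in [F]; but [M0 + (1 - M0 *m N0) *m G] has the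
same restriction to [F] for every [G], and finitely many rational [G] suffice to get one
injective on each given [B] of dimension at most [k] (exists_perturbed_inj). These maps
also give the irrationality of [A]: composed with [N0], they send [B] to a rational
subspace of [F] of the same dimension containing the intersection of [A] and [B].
*)

(** * Euclidean geometry *)

Section Euclid.
Variables (R : realType) (n : nat).
Implicit Types (x y z : 'rV[R]_n) (a : R).

Lemma dotvC x y : dotv x y = dotv y x.
Proof. by apply: eq_bigr => i _; rewrite mulrC. Qed.

Lemma dotvDl x y z : dotv (x + y) z = dotv x z + dotv y z.
Proof. by rewrite -big_split /=; apply: eq_bigr => i _; rewrite mxE mulrDl. Qed.

Lemma dotvZl a x z : dotv (a *: x) z = a * dotv x z.
Proof. by rewrite big_distrr /=; apply: eq_bigr => i _; rewrite mxE mulrA. Qed.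

Lemma dotvDr x y z : dotv z (x + y) = dotv z x + dotv z y.
Proof. by rewrite dotvC dotvDl !(dotvC z). Qed.

Lemma dotvZr a x z : dotv z (a *: x) = a * dotv z x.
Proof. by rewrite dotvC dotvZl (dotvC z). Qed.

Lemma dotvBl x y z : dotv (x - y) z = dotv x z - dotv y z.
Proof. by rewrite -scaleN1r dotvDl dotvZl mulN1r. Qed.

Lemma dotvBr x y z : dotv z (x - y) = dotv z x - dotv z y.
Proof. by rewrite dotvC dotvBl !(dotvC z). Qed.

Lemma dotv0l z : dotv 0 z = 0.
Proof. by rewrite -(scale0r 0) dotvZl mul0r. Qed.

Lemma dotv_enorm x : dotv x x = enorm x ^+ 2.
Proof.
rewrite sqr_sqrtr; last by apply: sumr_ge0 => i _; exact: sqr_ge0.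
by apply: eq_bigr => i _; rewrite expr2.
Qed.

Lemma enorm_ge0 x : 0 <= enorm x.
Proof. exact: sqrtr_ge0. Qed.

Lemma enorm_eq0 x : (enorm x == 0) = (x == 0).
Proof.
apply/eqP/eqP => [x0|->]; last first.
  by apply/eqP; have /eqP := dotv_enorm 0; rewrite dotv0l eq_sym expf_eq0.
have /psumr_eq0P h : \sum_(i < n) x 0 i * x 0 i = 0.
  by have := dotv_enorm x; rewrite x0 expr0n.
apply/rowP => i; rewrite mxE; apply/eqP.
by rewrite -[_ == 0]orbb -mulf_eq0 h // => k _; rewrite -expr2 sqr_ge0.
Qed.

Lemma enorm0 : enorm (0 : 'rV[R]_n) = 0.
Proof. by apply/eqP; rewrite enorm_eq0. Qed.

Lemma enorm_gt0 x : (0 < enorm x) = (x != 0).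
Proof. by rewrite lt_def enorm_eq0 enorm_ge0 andbT. Qed.

Lemma enormZ a x : enorm (a *: x) = `|a| * enorm x.
Proof.
apply/eqP; rewrite -(@eqrXn2 _ 2) ?enorm_ge0 ?mulr_ge0 ?enorm_ge0 //.
by rewrite -dotv_enorm dotvZl dotvZr dotv_enorm exprMn real_normK ?num_real // mulrA expr2.
Qed.

Lemma enorm_unit x : x != 0 -> enorm ((enorm x)^-1 *: x) = 1.
Proof.
move=> x0; rewrite enormZ ger0_norm ?invr_ge0 ?enorm_ge0 //.
by rewrite mulVf // enorm_eq0.
Qed.

(** Lagrange's identity. *)
Lemma wedge_normE x y :
  wedge_norm x y ^+ 2 = (enorm x * enorm y) ^+ 2 - dotv x y ^+ 2.
Proof.
rewrite sqr_sqrtr; last first.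
  by apply: sumr_ge0 => i _; apply: sumr_ge0 => k _; exact: sqr_ge0.
pose F i k := (x 0 i * y 0 k - x 0 k * y 0 i) ^+ 2.
set S := (X in X = _); rewrite exprMn -!dotv_enorm.
have SE : \sum_(i < n) \sum_(k < n) F i k = S *+ 2.
  rewrite mulr2n /S; under eq_bigr => i _ do
    rewrite (bigID (fun k : 'I_n => (i < k)%N)) /=.
  rewrite big_split /=; congr (_ + _).
  under eq_bigr => i _ do rewrite big_mkcond.
  rewrite exchange_big /=; apply: eq_bigr => i _.
  rewrite [in RHS]big_mkcond; apply: eq_bigr => k _.
  rewrite -leqNgt leq_eqVlt; case: (ltngtP i k) => [||/val_inj->] //=.
  - by move=> _; rewrite /F; ring.
  - by rewrite /F subrr expr0n.
have : S *+ 2 = (dotv x x * dotv y y - dotv x y ^+ 2) *+ 2.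
  have FE i : \sum_(k < n) F i k = (x 0 i * x 0 i) * dotv y y +
      ((y 0 i * y 0 i) * dotv x x + (- 2 * (x 0 i * y 0 i)) * dotv x y).
    rewrite !big_distrr -!big_split; apply: eq_bigr => k _ /=.
    by rewrite /F; ring.
  rewrite -SE (eq_bigr _ (fun i _ => FE i)) !big_split /= -!big_distrl /=.
  rewrite -big_distrr /=.
  rewrite -/(dotv x x) -/(dotv y y) -/(dotv x y); ring.
by move=> /eqP; rewrite eqrMn2r => /eqP.
Qed.

Lemma dotv_le_enorm x y : `|dotv x y| <= enorm x * enorm y.
Proof.
rewrite -(@ler_pXn2r _ 2) ?nnegrE ?mulr_ge0 ?enorm_ge0 // real_normK ?num_real //.
by rewrite -subr_ge0 -wedge_normE sqr_ge0.
Qed.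

Lemma enormD x y : enorm (x + y) <= enorm x + enorm y.
Proof.
rewrite -(@ler_pXn2r _ 2) ?nnegrE ?addr_ge0 ?enorm_ge0 //.
rewrite -dotv_enorm dotvDl !dotvDr (dotvC y x) !dotv_enorm sqrrD.
have := le_trans (ler_norm _) (dotv_le_enorm x y); lra.
Qed.

Lemma enormB x y : enorm (x - y) = enorm (y - x).
Proof. by rewrite -opprB -scaleN1r enormZ normrN1 mul1r. Qed.

Lemma enorm_triangle x y : enorm y <= enorm x + enorm (y - x).
Proof. by rewrite (le_trans _ (enormD _ _)) // addrC subrK. Qed.

Lemma enorm_coord x i : `|x 0 i| <= enorm x.
Proof.
rewrite -(@ler_pXn2r _ 2) ?nnegrE ?enorm_ge0 // real_normK ?num_real //.
rewrite -dotv_enorm /dotv (bigD1 i) //= -expr2 lerDl.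
by apply: sumr_ge0 => k _; rewrite -expr2 sqr_ge0.
Qed.

Lemma psi_ge0 x y : 0 <= psi x y.
Proof. by rewrite divr_ge0 ?sqrtr_ge0 ?mulr_ge0 ?enorm_ge0. Qed.

Lemma psi_sqr x y : x != 0 -> y != 0 ->
  psi x y ^+ 2 = 1 - dotv x y ^+ 2 / (enorm x * enorm y) ^+ 2.
Proof.
move=> x0 y0; rewrite /psi expr_div_n wedge_normE mulrBl divff //.
by rewrite expf_eq0 mulf_eq0 !enorm_eq0 (negbTE x0) (negbTE y0).
Qed.

Lemma psi_le1 x y : psi x y <= 1.
Proof.
have [->|x0] := eqVneq x 0; first by rewrite /psi enorm0 mul0r invr0 mulr0.
have [->|y0] := eqVneq y 0; first by rewrite /psi enorm0 mulr0 invr0 mulr0.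
rewrite -(@ler_pXn2r _ 2) ?nnegrE ?psi_ge0 // psi_sqr // expr1n.
by rewrite gerBl divr_ge0 ?sqr_ge0.
Qed.

Lemma psiZ a b x y : a != 0 -> b != 0 -> psi (a *: x) (b *: y) = psi x y.
Proof.
move=> a0 b0; have [->|x0] := eqVneq x 0.
  by rewrite /psi scaler0 enorm0 !mul0r invr0 !mulr0.
have [->|y0] := eqVneq y 0.
  by rewrite /psi scaler0 enorm0 !mulr0 invr0 !mulr0.
apply/eqP; rewrite -(@eqrXn2 _ 2) ?psi_ge0 // !psi_sqr ?scaler_eq0 ?negb_or ?a0 ?b0 //.
rewrite dotvZl dotvZr !enormZ !exprMn !real_normK ?num_real //; apply/eqP; congr (_ - _).
by field; rewrite !enorm_eq0 x0 y0 a0 b0.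
Qed.

(** For a unit vector [y], [psi x y] is the distance from [y] to the line spanned by
    [x], and [x] is a point of that line. *)
Lemma psi_le_dist x y : x != 0 -> y != 0 -> psi x y <= enorm (y - x) / enorm y.
Proof.
move=> x0 y0; rewrite /psi invfM mulrA ler_pM2r ?invr_gt0 ?enorm_gt0 //.
rewrite ler_pdivrMr ?enorm_gt0 // mulrC.
rewrite -(@ler_pXn2r _ 2) ?nnegrE ?sqrtr_ge0 ?mulr_ge0 ?enorm_ge0 //.
rewrite wedge_normE !exprMn -(dotv_enorm (y - x)) dotvBr !dotvBl !dotv_enorm.
rewrite (dotvC y x) -subr_ge0.
have := sqr_ge0 (enorm x ^+ 2 - dotv x y); set a := enorm x; set b := enorm y.
by set c := dotv x y; congr (0 <= _); ring.
Qed.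

End Euclid.

(** A crude bound for the operator norm of [x |-> x *m M]: its size is irrelevant for
    exponents. *)
Definition mxbound (R : realType) (n m : nat) (M : 'M[R]_(n, m)) : R :=
  \sum_(i < n) enorm (row i M).

Lemma mxbound_ge0 (R : realType) (n m : nat) (M : 'M[R]_(n, m)) : 0 <= mxbound M.
Proof. by apply: sumr_ge0 => i _; exact: enorm_ge0. Qed.

Lemma enorm_sum (R : realType) (n : nat) I (r : seq I) (f : I -> 'rV[R]_n) :
  enorm (\sum_(i <- r) f i) <= \sum_(i <- r) enorm (f i).
Proof.
elim: r => [|i r IH]; first by rewrite !big_nil enorm0.
by rewrite !big_cons (le_trans (enormD _ _)) // lerD2l.
Qed.

Lemma enorm_mulmx (R : realType) (n m : nat) (M : 'M[R]_(n, m)) x :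
  enorm (x *m M) <= mxbound M * enorm x.
Proof.
rewrite mulmx_sum_row (le_trans (enorm_sum _ _)) // mulr_suml.
by apply: ler_sum => i _; rewrite enormZ mulrC ler_wpM2l ?enorm_ge0 ?enorm_coord.
Qed.

(** * Existence of minimizing pairs *)

Section Minimizers.
Variables (R : realType) (n : nat).
Implicit Types (A B U : {vspace 'rV[R]_n}) (s : seq ('rV[R]_n * 'rV[R]_n)).

Lemma exists_orthogonal U (s : seq 'rV[R]_n) : (size s < \dim U)%N ->
  exists y, [/\ y \in U, y != 0 & forall z, z \in s -> dotv y z = 0].
Proof.
move=> sU.
pose W : 'M[R]_(n, size s) := \matrix_(l, i) (s`_i) 0 l.
pose f := linfun (mulmxr W : 'rV[R]_n -> 'rV[R]_(size s)).
have dimker : (0 < \dim (U :&: lker f))%N.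
  rewrite -(ltn_add2r (\dim (f @: U)%VS)) limg_ker_dim add0n.
  rewrite (leq_ltn_trans _ sU) // (leq_trans (dimvS (subvf _))) //.
  by rewrite dimvf /dim /= mul1n.
exists (vpick (U :&: lker f)%VS); set y := vpick _.
have : y \in (U :&: lker f)%VS by exact: memv_pick.
rewrite memv_cap => /andP[yU]; rewrite memv_ker lfunE /= => /eqP yW.
split => //; first by rewrite vpick0 -dimv_eq0 -lt0n.
move=> z /(nthP 0) [i i_s <-].
have /(congr1 (fun v : 'rV_(size s) => v 0 (Ordinal i_s))) := yW.
rewrite !mxE => <-; apply: eq_bigr => l _.
by rewrite mxE.
Qed.

Lemma dotv_continuous (T : topologicalType) (f g : T -> 'rV[R]_n) :
  continuous f -> continuous g -> continuous (fun p => dotv (f p) (g p)).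
Proof.
move=> cf cg; apply: continuous_big => [|i _ p]; first exact: add_continuous.
have cc (h : T -> 'rV[R]_n) : continuous h -> {for p, continuous (fun p => h p 0 i)}.
  move=> ch; apply: (@continuous_comp _ _ _ h (fun x : 'rV[R]_n => x 0 i)).
    exact: ch.
  exact: coord_continuous.
by apply: continuousM; exact: cc.
Qed.

Lemma closed_dotv_eq (T : topologicalType) (f g : T -> 'rV[R]_n) (a : R) :
  continuous f -> continuous g -> closed [set p | dotv (f p) (g p) = a].
Proof.
move=> cf cg.
exact: (continuous_closedP _).1 (dotv_continuous cf cg) _ (@closed_eq R a).
Qed.

(** A subspace is cut out by linear equations, here those of the matrix of
    the projection onto a complement. *)
Lemma closed_memv (T : topologicalType) (f : T -> 'rV[R]_n) U :
  continuous f -> closed [set p | f p \in U].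
Proof.
move=> cf; pose W := (lin1_mx (projv U) - 1%:M)^T.
have -> : [set p | f p \in U] =
    \bigcap_(l in [set: 'I_n]) [set p | dotv (f p) (row l W) = 0].
  have dotE p l : dotv (f p) (row l W) = (projv U (f p) - f p) 0 l.
    rewrite -[in RHS]mul_rV_lin1 -[X in _ - X]mulmx1 -mulmxBr mxE.
    by apply: eq_bigr => i _; rewrite !mxE.
  apply/seteqP; split => p /=.
    by move=> fU l _ /=; rewrite dotE projv_id // subrr mxE.
  move=> h; suff -> : f p = projv U (f p) by exact: memv_proj.
  apply/eqP; rewrite -subr_eq0 -oppr_eq0 opprB; apply/eqP/rowP => l.
  by rewrite -dotE [RHS]mxE; exact: h.
apply: closed_bigI => l _; apply: closed_dotv_eq => // p; exact: cst_continuous.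
Qed.

Lemma rV_unit_compact : compact [set x : 'rV[R]_n | forall i, `[-1, 1]%classic (x 0 i)].
Proof.
exact: (@rV_compact R n (fun=> `[-1, 1]%classic) (fun i => @segment_compact R (-1) 1)).
Qed.

(** [psi] depends only on the directions of its arguments, and the unit admissible pairs
    form a compact set, on which minimizing [psi] amounts to maximizing the square of
    the inner product. *)
Lemma exists_minimizing A B s :
  admissible A B s !=set0 -> minimizing A B s !=set0.
Proof.
move=> [p0 [p0A p00 p0B p00' p0s]].
pose K : set ('rV[R]_n * 'rV[R]_n) :=
  [set p | p.1 \in A] `&` [set p | p.2 \in B] `&`
  [set p | dotv p.1 p.1 = 1] `&` [set p | dotv p.2 p.2 = 1] `&`
  \bigcap_(q in [set` s]) ([set p | dotv p.1 q.1 = 0] `&` [set p | dotv p.2 q.2 = 0]).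
have c1 : continuous (fun p : 'rV[R]_n * 'rV[R]_n => p.1) by move=> p; exact: cvg_fst.
have c2 : continuous (fun p : 'rV[R]_n * 'rV[R]_n => p.2) by move=> p; exact: cvg_snd.
have Kclosed : closed K.
  apply: closedI; first apply: closedI; first apply: closedI; first apply: closedI.
  - exact: (@closed_memv _ _ A c1).
  - exact: (@closed_memv _ _ B c2).
  - exact: (@closed_dotv_eq _ _ _ 1 c1 c1).
  - exact: (@closed_dotv_eq _ _ _ 1 c2 c2).
  apply: closed_bigI => q _; apply: closedI.
    exact: (@closed_dotv_eq _ _ _ 0 c1 (fun p => @cst_continuous _ _ q.1 p)).
  exact: (@closed_dotv_eq _ _ _ 0 c2 (fun p => @cst_continuous _ _ q.2 p)).
have unitE x : dotv x x = 1 <-> enorm x = 1.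
  rewrite dotv_enorm; split => [/eqP|->]; last by rewrite expr1n.
  by rewrite sqrp_eq1 ?enorm_ge0 // => /eqP.
have Kcompact : compact K.
  apply: (subclosed_compact Kclosed (compact_setX rV_unit_compact rV_unit_compact)).
  move=> p [[[_ /unitE p1] /unitE p2] _]; split => i /=.
    by rewrite in_itv /= -ler_norml -p1 enorm_coord.
  by rewrite in_itv /= -ler_norml -p2 enorm_coord.
pose g (p : 'rV[R]_n * 'rV[R]_n) := dotv p.1 p.2 ^+ 2.
have Knonempty : K !=set0.
  exists ((enorm p0.1)^-1 *: p0.1, (enorm p0.2)^-1 *: p0.2).
  split; last by move=> q /p0s [q1 q2]; split; rewrite /= dotvZl ?q1 ?q2 mulr0.
  do ![split]; rewrite /= ?memvZ //; by apply/unitE/enorm_unit.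
have gcont : {within K, continuous g}.
  apply: continuous_subspaceT => p.
  apply: (@continuous_comp _ _ _ (fun p => dotv p.1 p.2) (fun x : R => x ^+ 2)).
    exact: (dotv_continuous c1 c2).
  exact: exprn_continuous.
have [p] := compact_EVT_max Knonempty Kcompact gcont.
rewrite inE => -[[[[pA pB] /unitE p1] /unitE p2] ps] pmin.
have nz x : enorm x = 1 -> x != 0 by move=> x1; rewrite -enorm_gt0 x1.
exists p; split => //; first by split; rewrite ?nz //; move=> q qs; exact: ps.
move=> q [qA q10 qB q20 qs].
rewrite -(@psiZ _ _ (enorm q.1)^-1 (enorm q.2)^-1 q.1 q.2) ?invr_eq0 ?enorm_eq0 //.
set x := _ *: q.1; set y := _ *: q.2.
have x1 : enorm x = 1 by exact: enorm_unit.
have y1 : enorm y = 1 by exact: enorm_unit.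
rewrite -(@ler_pXn2r _ 2) ?nnegrE ?psi_ge0 // !psi_sqr ?nz //.
rewrite x1 y1 p1 p2 mulr1 expr1n !divr1 lerD2l lerN2.
apply: (pmin (x, y)); rewrite inE; split; last first.
  by move=> r /qs [r1 r2]; split; rewrite /= dotvZl ?r1 ?r2 mulr0.
do ![split]; rewrite /= ?memvZ //; by apply/unitE.
Qed.

End Minimizers.

(** * Principal angles *)

Section Orthonormal.
Variables (R : realType) (n : nat).
Implicit Types (x y z : 'rV[R]_n) (s : seq 'rV[R]_n).

Fixpoint orthonormal s : Prop :=
  if s is y :: s' then
    [/\ enorm y = 1, forall z, z \in s' -> dotv y z = 0 & orthonormal s']
  else True.

Definition proj_seq s x : 'rV[R]_n := \sum_(z <- s) dotv x z *: z.

Lemma dotv_suml I (r : seq I) (f : I -> 'rV[R]_n) x :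
  dotv (\sum_(i <- r) f i) x = \sum_(i <- r) dotv (f i) x.
Proof.
elim: r => [|i r IH]; first by rewrite !big_nil dotv0l.
by rewrite !big_cons dotvDl IH.
Qed.

Lemma orthonormal_unit s z : orthonormal s -> z \in s -> enorm z = 1.
Proof.
elim: s => //= y s IH [y1 _ /IH h]; rewrite inE => /orP[/eqP->|] //.
Qed.

Lemma proj_seq_orth s x z : orthonormal s -> z \in s ->
  dotv (x - proj_seq s x) z = 0.
Proof.
elim: s => //= y s IH [y1 ys os].
rewrite /proj_seq big_cons -/(proj_seq s x) opprD addrCA addrC dotvDl -scaleNr dotvZl inE.
case/orP => [/eqP->|zs].
  rewrite dotvBl dotv_enorm y1 expr1n mulr1 /proj_seq dotv_suml.
  rewrite big1_seq ?subr0 ?subrr // => z' /andP[_ z's].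
  by rewrite dotvZl (dotvC z') ys ?mulr0.
by rewrite IH // ys // mulr0 addr0.
Qed.

Lemma orthonormal_span s x : orthonormal s -> x \in span s -> proj_seq s x = x.
Proof.
elim: s x => [|y s IH] x /=.
  by rewrite span_nil memv0 => _ /eqP->; rewrite /proj_seq big_nil.
move=> [y1 ys os]; rewrite span_cons => /memv_addP[_ /vlineP[a ->] [u us ->]].
have uy : dotv u y = 0.
  rewrite -(IH u) // dotv_suml big1_seq // => z /andP[_ zs].
  by rewrite dotvZl (dotvC z) ys ?mulr0.
rewrite /proj_seq big_cons dotvDl dotvZl dotv_enorm y1 expr1n mulr1 uy addr0.
congr (_ + _); rewrite -[RHS]IH //; apply: eq_big_seq => z zs.
by rewrite dotvDl dotvZl ys // mulr0 add0r.
Qed.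

Lemma orthonormal_free s : orthonormal s -> free s.
Proof.
elim: s => [|y s IH] /=; first by rewrite nil_free.
move=> [y1 ys os]; rewrite free_cons IH // andbT; apply/negP => /(orthonormal_span os).
rewrite /proj_seq big1_seq => [y0|z /andP[_ zs]]; last by rewrite ys ?scale0r.
by move: y1; rewrite -y0 enorm0 => /esym/eqP; rewrite oner_eq0.
Qed.

End Orthonormal.

Section PrincipalPairs.
Variables (R : realType) (n : nat) (A B : {vspace 'rV[R]_n}).
Local Notation pp := (principal_pairs A B).

Lemma size_principal_pairs j : size (pp j) = j.
Proof. by elim: j => //= j ->. Qed.

Lemma principal_minimizing j : (j < \dim A)%N -> (j < \dim B)%N ->
  minimizing A B (pp j) (xget (0, 0) (minimizing A B (pp j))).
Proof.
move=> jA jB; apply: xgetPex; apply: exists_minimizing.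
have [|x [xA x0 xs]] := @exists_orthogonal _ _ A (unzip1 (pp j)).
  by rewrite size_map size_principal_pairs.
have [|y [yB y0 ys]] := @exists_orthogonal _ _ B (unzip2 (pp j)).
  by rewrite size_map size_principal_pairs.
exists (x, y); split => // q qs; split.
  by apply: xs; exact: map_f.
by apply: ys; exact: map_f.
Qed.

Lemma admissible_behead (s : seq ('rV[R]_n * 'rV[R]_n)) p q :
  admissible A B (p :: s) q -> admissible A B s q.
Proof. by move=> [? ? ? ? h]; split => // r rs; apply: h; rewrite inE rs orbT. Qed.

(** If [y] is orthogonal to [p.2], tilting [p.2] towards [y] would decrease the
    angle with [p.1] unless [y] is orthogonal to [p.1] as well. *)
Lemma minimizing_orth (s : seq ('rV[R]_n * 'rV[R]_n)) p y :
  minimizing A B s p -> y \in B -> (forall q, q \in s -> dotv y q.2 = 0) ->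
  dotv y p.2 = 0 -> dotv p.1 y = 0.
Proof.
move=> [[pA p10 pB p20 ps] x1 y1 pmin] yB ys yp; apply/eqP/negPn/negP => a0.
set a := dotv p.1 y in a0; set b := dotv p.1 p.2; set N := enorm y ^+ 2.
have N0 : 0 < N.
  rewrite exprn_gt0 // enorm_gt0; apply: contraNneq a0 => y0.
  by rewrite /a y0 dotvC dotv0l.
have a2 : 0 < a ^+ 2 by rewrite exprn_even_gt0.
(* This vector is proportional to the projection of p.1 onto the span of p.2 and y *)
pose z := (b * N) *: p.2 + a *: y.
have zz : dotv z z = N * (b ^+ 2 * N + a ^+ 2).
  rewrite /z !(dotvDl, dotvDr, dotvZl, dotvZr) (dotvC p.2) yp !dotv_enorm y1 -/N.
  ring.
have pz : dotv p.1 z = b ^+ 2 * N + a ^+ 2.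
  by rewrite dotvDr !dotvZr -/a -/b; ring.
have D0 : 0 < b ^+ 2 * N + a ^+ 2 by rewrite ltr_wpDl // mulr_ge0 ?sqr_ge0 ?ltW.
have z0 : z != 0.
  by apply: contraTneq D0 => z0; rewrite -pz z0 dotvC dotv0l ltxx.
have zadm : admissible A B s (p.1, z).
  split => //=; first by rewrite memvD ?memvZ.
  move=> q qs; have [h1 h2] := ps _ qs; split => //.
  by rewrite dotvDl !dotvZl h2 ys // !mulr0 addr0.
have := pmin _ zadm; rewrite -(@ler_pXn2r _ 2) ?nnegrE ?psi_ge0 //=.
rewrite !psi_sqr // pz !exprMn -(dotv_enorm z) zz x1 y1 !expr1n !mul1r divr1 -/b.
rewrite lerD2l lerN2; apply/negP; rewrite -ltNge ltr_pdivlMr; last exact: mulr_gt0.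
rewrite expr2 mulrA ltr_pM2r // mulrC.
rewrite -subr_gt0 (_ : _ - _ = a ^+ 2) //; ring.
Qed.

Lemma principal_pairsP j : (j <= \dim A)%N -> (j <= \dim B)%N ->
  [/\ orthonormal (unzip1 (pp j)), orthonormal (unzip2 (pp j)) &
      forall q, q \in pp j -> q.1 \in A /\ q.2 \in B].
Proof.
elim: j => [|j IH] //= jA jB.
have [ onA onB mAB] := IH (ltnW jA) (ltnW jB).
case: (principal_minimizing jA jB) => -[pA p10 pB p20 ps] x1 y1 _.
set p := xget _ _ in pA p10 pB p20 ps x1 y1 *.
split => [||q]; last by rewrite inE => /orP[/eqP->|/mAB].
  by split => // _ /mapP[q qs ->]; have [] := ps q qs.
by split => // _ /mapP[q qs ->]; have [] := ps q qs.
Qed.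

(** The sines increase along the recursion, since the admissible sets decrease. *)
Lemma principal_pairs_psi j q p : (j <= \dim A)%N -> (j <= \dim B)%N ->
  q \in pp j -> admissible A B (pp j) p -> psi q.1 q.2 <= psi p.1 p.2.
Proof.
elim: j q p => [|j IH] //= q p jA jB.
rewrite inE => /orP[/eqP->|qs] /admissible_behead padm.
  by have [_ _ _] := principal_minimizing jA jB; apply.
exact: IH (ltnW jA) (ltnW jB) qs padm.
Qed.

Lemma psi_le_psi_idx j q : (j <= \dim A)%N -> (j <= \dim B)%N ->
  q \in pp j -> psi q.1 q.2 <= psi_idx j A B.
Proof.
case: j => [|j] //= jA jB; rewrite inE => /orP[/eqP->|qs] //.
have [h _ _ _] := principal_minimizing jA jB.
exact: (principal_pairs_psi (ltnW jA) (ltnW jB) qs h).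
Qed.

Lemma principal_pairs_orth j q y : (j <= \dim A)%N -> (j <= \dim B)%N ->
  q \in pp j -> y \in B -> (forall r, r \in pp j -> dotv y r.2 = 0) ->
  dotv q.1 y = 0.
Proof.
elim: j q => [|j IH] //= q jA jB qs yB yorth.
have yorth' r : r \in pp j -> dotv y r.2 = 0 by move=> rs; apply: yorth; rewrite inE rs orbT.
move: qs; rewrite inE => /orP[/eqP->|qs]; last exact: IH (ltnW jA) (ltnW jB) qs yB yorth'.
apply: (minimizing_orth (principal_minimizing jA jB)) => //.
by apply: yorth; rewrite inE eqxx.
Qed.

Lemma psi_idx_ge0 j : 0 <= psi_idx j A B.
Proof. exact: psi_ge0. Qed.

Lemma psi_idx_le1 j : psi_idx j A B <= 1.
Proof. exact: psi_le1. Qed.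

(** [U] is spanned by the vectors [q.2] of the first [j] principal pairs: they are
    orthonormal, and each is at distance [psi q.1 q.2] from the line of [q.1]. *)
Lemma psi_idx_close j : (j <= \dim A)%N -> (j <= \dim B)%N ->
  exists U : {vspace 'rV[R]_n}, [/\ (U <= B)%VS, \dim U = j &
    forall y, y \in U -> exists2 x, x \in A &
      enorm (y - x) <= j%:R * psi_idx j A B * enorm y].
Proof.
move=> jA jB; have [ onA onB mAB] := principal_pairsP jA jB.
exists <<unzip2 (pp j)>>%VS; split.
- by apply/span_subvP => _ /mapP[q /mAB[_ qB] ->].
- by have /eqnP -> := orthonormal_free onB; rewrite size_map size_principal_pairs.
move=> y yU; exists (\sum_(q <- pp j) (dotv y q.2 * dotv q.1 q.2) *: q.1).
  by rewrite big_seq; apply: memv_suml => q /mAB[qA _]; exact: memvZ.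
rewrite -{1}(orthonormal_span onB yU) /proj_seq big_map -sumrB.
apply: (le_trans (enorm_sum _ _)).
have -> : j%:R * psi_idx j A B * enorm y = \sum_(q <- pp j) psi_idx j A B * enorm y.
  by rewrite big_const_seq count_predT size_principal_pairs iter_addr_0 -[RHS]mulr_natl mulrA.
rewrite big_seq [leRHS]big_seq; apply: ler_sum => q qs.
have q11 : enorm q.1 = 1 by apply: (orthonormal_unit onA); exact: map_f.
have q21 : enorm q.2 = 1 by apply: (orthonormal_unit onB); exact: map_f.
rewrite -scalerA -scalerBr enormZ mulrC ler_pM ?enorm_ge0 //; last first.
  by rewrite (le_trans (dotv_le_enorm _ _)) // q21 mulr1.
apply: le_trans (psi_le_psi_idx jA jB qs).
rewrite -(@ler_pXn2r _ 2) ?nnegrE ?psi_ge0 ?enorm_ge0 //.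
rewrite psi_sqr -?enorm_gt0 ?q11 ?q21 // mulr1 expr1n divr1 -dotv_enorm.
rewrite !(dotvBl, dotvBr, dotvZl, dotvZr) !dotv_enorm q11 q21 (dotvC q.2).
by rewrite le_eqVlt; apply/orP; left; apply/eqP; ring.
Qed.

(** A vector [y] of [U] orthogonal to the first [j - 1] vectors chosen in [B] is also
    orthogonal to the vectors chosen in [A], so that subtracting from a
    vector of [A] close to [y] its components along them keeps it close to [y]. *)
Lemma psi_idx_le j (U : {vspace 'rV[R]_n}) (c : R) :
  (0 < j)%N -> (j <= \dim A)%N -> (U <= B)%VS -> (j <= \dim U)%N ->
  (forall y, y \in U -> exists2 x, x \in A & enorm (y - x) <= c * enorm y) ->
  psi_idx j A B <= j%:R * c.
Proof.
case: j => // j _ jA UB jU close; have jB := leq_trans jU (dimvS UB).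
have [ onA onB mAB] := principal_pairsP (ltnW jA) (ltnW jB).
have [|y [yU y0 yorth]] := @exists_orthogonal _ _ U (unzip2 (pp j)).
  by rewrite size_map size_principal_pairs.
have {}yorth q : q \in pp j -> dotv y q.2 = 0 by move=> qs; apply: yorth; exact: map_f.
have yB : y \in B by exact: (subvP UB).
have [x xA xy] := close y yU.
pose x' := x - proj_seq (unzip1 (pp j)) x.
have x'A : x' \in A.
  rewrite memvB // /proj_seq big_map big_seq; apply: memv_suml => q /mAB[qA _].
  exact: memvZ.
have x'y : enorm (y - x') <= j.+1%:R * c * enorm y.
  rewrite /x' opprB addrCA addrC.
  rewrite (le_trans (enormD _ _)) // -nat1r mulrDl mulrDl mul1r lerD //.
  rewrite /proj_seq big_map (le_trans (enorm_sum _ _)) //.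
  have -> : j%:R * c * enorm y = \sum_(q <- pp j) c * enorm y.
    by rewrite big_const_seq count_predT size_principal_pairs iter_addr_0 -[RHS]mulr_natl mulrA.
  rewrite big_seq [leRHS]big_seq; apply: ler_sum => q qs.
  have q11 : enorm q.1 = 1 by apply: (orthonormal_unit onA); exact: map_f.
  rewrite enormZ q11 mulr1.
  have -> : dotv x q.1 = - dotv (y - x) q.1.
    rewrite dotvBl (dotvC y) (principal_pairs_orth (ltnW jA) (ltnW jB) qs yB) //.
    by rewrite sub0r opprK.
  by rewrite normrN (le_trans (dotv_le_enorm _ _)) // q11 mulr1.
have [x'0|x'0] := eqVneq x' 0.
  apply: le_trans (psi_idx_le1 _) _; move: x'y; rewrite x'0 subr0.
  by rewrite -ler_pdivrMr ?enorm_gt0 // divff // enorm_eq0.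
apply: (@le_trans _ _ (psi x' y)); last first.
  by rewrite (le_trans (psi_le_dist _ _)) // ler_pdivrMr ?enorm_gt0.
have [_ _ _ pmin] := principal_minimizing jA jB; apply: (pmin (x', y)).
split => //= q qs; split; last exact: yorth.
by apply: proj_seq_orth => //; exact: map_f.
Qed.

(** The subspace of [psi_idx_close] is then contained in [A]. *)
Lemma psi_idx_eq0 j : (j <= \dim A)%N -> (j <= \dim B)%N ->
  psi_idx j A B = 0 -> (j <= \dim (A :&: B))%N.
Proof.
move=> jA jB psi0; have [U [UB dimU close]] := psi_idx_close jA jB.
rewrite -[X in (X <= _)%N]dimU; apply: dimvS.
apply/subvP => y yU; rewrite memv_cap (subvP UB) // andbT.
have [x xA] := close y yU; rewrite psi0 mulr0 mul0r => yx.
suff : y - x == 0 by rewrite subr_eq0 => /eqP->.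
by rewrite -enorm_eq0 eq_le yx enorm_ge0.
Qed.

End PrincipalPairs.

(** Since [N] inverts [M] on [A], a vector [y] close to [A] is not contracted much
    by [M]: [enorm y <= 2 * mxbound N * enorm (y *m M)]. When [psi_idx j A B] is not
    small, the bound holds because every sine is at most [1]. *)
Lemma psi_idx_img (R : realType) (n m : nat) (M : 'M[R]_(n, m)) (N : 'M[R]_(m, n))
    (A B : {vspace 'rV[R]_n}) j (f := linfun (mulmxr M : 'rV[R]_n -> 'rV[R]_m)) :
  (0 < j)%N -> (j <= \dim A)%N -> (j <= \dim B)%N ->
  (forall x, x \in A -> x *m M *m N = x) -> (B :&: lker f = 0)%VS ->
  psi_idx j (f @: A) (f @: B) <=
    2 * j%:R ^+ 2 * (1 + mxbound M * mxbound N) * psi_idx j A B.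
Proof.
move=> j0 jA jB MN kerB; have fE x : f x = x *m M by rewrite lfunE.
have [U [UB dimU close]] := psi_idx_close jA jB.
have kerA : (A :&: lker f = 0)%VS.
  apply/eqP; rewrite -subv0; apply/subvP => x; rewrite memv_cap memv_ker fE.
  by case/andP => xA /eqP xM; rewrite memv0 -(MN x) // xM mul0mx.
have kerU : (U :&: lker f = 0)%VS.
  by apply/eqP; rewrite -subv0 -kerB; exact: capvS.
have jfA : (j <= \dim (f @: A))%N by rewrite limg_dim_eq.
set s := psi_idx j A B in close *; set a := mxbound M; set b := mxbound N.
have a0 : 0 <= a by exact: mxbound_ge0.
have b0 : 0 <= b by exact: mxbound_ge0.
have s0 : 0 <= s by exact: psi_idx_ge0.
have j1 : 1 <= j%:R :> R by rewrite ler1n.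
have ab0 : 0 <= a * b by rewrite mulr_ge0.
have ab1 : 0 <= 1 + a * b by rewrite addr_ge0.
have [small|big] := leP (j%:R * s * (1 + a * b)) (1 / 2); last first.
  apply: le_trans (psi_idx_le1 _ _ _) _.
  have t0 : 0 <= j%:R :> R by exact: ler0n.
  move: (j%:R) t0 j1 big => t t0 j1 big.
  have h : 0 <= (t - 1) * (t * s * (1 + a * b)).
    apply: mulr_ge0; first by rewrite subr_ge0.
    by apply: mulr_ge0 => //; exact: mulr_ge0.
  rewrite (_ : 2 * _ * _ * s = 2 * t * (t * s * (1 + a * b))); last by ring.
  by move: big h; set P := t * s * _; lra.
have := @psi_idx_le _ _ (f @: A)%VS (f @: B)%VS j (f @: U)%VS
  (2 * a * b * (j%:R * s)) j0 jfA (limgS _ UB).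
rewrite limg_dim_eq // dimU => /(_ (leqnn _)) H.
apply: le_trans (H _) _ => [_ /memv_imgP[y yU ->]|]; last first.
  have : 0 <= j%:R ^+ 2 * s by rewrite mulr_ge0 // exprn_ge0.
  by set t := j%:R : R; nra.
have [x xA xy] := close y yU; exists (f x); first exact: memv_img.
rewrite !fE -mulmxBl; apply: (le_trans (enorm_mulmx M (y - x))).
have ynorm : enorm y <= 2 * b * enorm (y *m M).
  have h1 : enorm x <= b * enorm (x *m M) by rewrite -{1}(MN x) // enorm_mulmx.
  have h2 : enorm y <= enorm x + enorm (y - x) by exact: enorm_triangle.
  have h3 : enorm (x *m M) <= enorm (y *m M) + a * enorm (y - x).
    apply: le_trans (enorm_triangle (y *m M) _) _; rewrite lerD2l enormB -mulmxBl.
    exact: enorm_mulmx.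
  have h4 : b * enorm (x *m M) <= b * (enorm (y *m M) + a * enorm (y - x)).
    exact: ler_wpM2l.
  have h5 : (1 + a * b) * enorm (y - x) <= (1 + a * b) * (j%:R * s * enorm y).
    exact: ler_wpM2l.
  have h6 : j%:R * s * (1 + a * b) * enorm y <= 1 / 2 * enorm y.
    by apply: ler_wpM2r => //; exact: enorm_ge0.
  by move: h1 h2 h4 h5 h6; set t := j%:R : R; nra.
have : a * enorm (y - x) <= a * (j%:R * s * enorm y) by exact: ler_wpM2l.
have : a * (j%:R * s) * enorm y <= a * (j%:R * s) * (2 * b * enorm (y *m M)).
  by apply: ler_wpM2l => //; apply: mulr_ge0 => //; exact: mulr_ge0.
by rewrite -/a; lra.
Qed.

(** * Bases, minors and Pluecker coordinates *)

Section RowBasis.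
Variables (R : realType) (n : nat).
Implicit Types (B : {vspace 'rV[R]_n}).

Definition rowbasis (e : nat) (X : 'M[R]_(e, n)) B : Prop :=
  row_free X /\ forall v : 'rV[R]_n, (v \in B) = (v <= X)%MS.

Definition tuple_mx (e : nat) (X : e.-tuple 'rV[R]_n) : 'M[R]_(e, n) :=
  \matrix_(i < e) tnth X i.

Lemma mulmx_tuple (e : nat) (X : e.-tuple 'rV[R]_n) (u : 'rV_e) :
  u *m tuple_mx X = \sum_i u 0 i *: X`_i.
Proof.
rewrite mulmx_sum_row; apply: eq_bigr => i _.
by rewrite rowK (tnth_nth 0).
Qed.

Lemma basis_rowbasis (e : nat) (X : e.-tuple 'rV[R]_n) B :
  basis_of B X -> rowbasis (tuple_mx X) B.
Proof.
move=> bX; split.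
  apply: inj_row_free => u; rewrite mulmx_tuple => uX.
  apply/rowP => i; rewrite mxE.
  by have /freeP := basis_free bX; apply.
move=> v; rewrite -(span_basis bX); apply/idP/submxP => [vX|[u ->]].
  exists (\row_i coord X i v); rewrite mulmx_tuple {1}(coord_span vX).
  by apply: eq_bigr => i _; rewrite mxE.
rewrite mulmx_tuple; apply: memv_suml => i _; apply: memvZ.
by rewrite memv_span // mem_nth // size_tuple.
Qed.

Lemma rowbasis_basis (e : nat) (X : 'M[R]_(e, n)) B :
  rowbasis X B -> basis_of B [tuple row i X | i < e].
Proof.
move=> [fX BX]; set T := [tuple row i X | i < e].
have TX : tuple_mx T = X by apply/row_matrixP => i; rewrite rowK tnth_mktuple.
apply/andP; split.
  rewrite eqEsubv; apply/andP; split.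
    apply/span_subvP => v /tnthP[i ->]; rewrite tnth_mktuple BX.
    exact: row_sub.
  apply/subvP => v; rewrite BX => /submxP[u ->]; rewrite -TX mulmx_tuple.
  apply: memv_suml => i _; apply: memvZ.
  by rewrite memv_span // mem_nth // size_tuple.
apply/freeP => k kT i; have : (\row_i k i) *m X = 0.
  by rewrite -TX mulmx_tuple -[RHS]kT; apply: eq_bigr => l _; rewrite mxE.
rewrite -(mul0mx _ X) => /(row_free_inj fX) /rowP /(_ i).
by rewrite !mxE.
Qed.

Lemma rowbasis_dim (e : nat) (X : 'M[R]_(e, n)) B : rowbasis X B -> \dim B = e.
Proof. by move/rowbasis_basis/size_basis. Qed.

Lemma rowbasis_change (e : nat) (X Y : 'M[R]_(e, n)) B :
  rowbasis X B -> rowbasis Y B -> exists2 P : 'M[R]_e, \det P != 0 & Y = P *m X.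
Proof.
move=> [fX BX] [fY BY].
have /submxP[P YP] : (Y <= X)%MS by apply/row_subP => i; rewrite -BX BY row_sub.
exists P => //; rewrite -unitfE -[_ \is a _]/(P \in unitmx) -row_free_unit.
apply: inj_row_free => u uP; apply: (row_free_inj fY).
by rewrite /= YP mulmxA uP !mul0mx.
Qed.

End RowBasis.

Lemma rowbasis_img (R : realType) (n m e : nat) (M : 'M[R]_(n, m))
    (X : 'M[R]_(e, n)) (B : {vspace 'rV[R]_n})
    (f := linfun (mulmxr M : 'rV[R]_n -> 'rV[R]_m)) :
  rowbasis X B -> (B :&: lker f = 0)%VS -> rowbasis (X *m M) (f @: B)%VS.
Proof.
move=> [fX BX] kerB; have fE x : f x = x *m M by rewrite lfunE.
split.
  apply: inj_row_free => u; rewrite mulmxA => uXM; apply: (row_free_inj fX).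
  have : u *m X \in (B :&: lker f)%VS.
    by rewrite memv_cap memv_ker fE uXM eqxx andbT BX submxMl.
  by rewrite kerB memv0 mul0mx => /eqP.
move=> v; apply/memv_imgP/submxP => [[x]|[u ->]].
  by rewrite BX => /submxP[u ->] ->; exists u; rewrite fE mulmxA.
by exists (u *m X); rewrite ?BX ?submxMl // fE mulmxA.
Qed.

Section Minors.
Variables (e n : nat).

Definition minor (K : comNzRingType) (X : 'M[K]_(e, n)) (f : {ffun 'I_e -> 'I_n}) : K :=
  \det (colsub f X).

Lemma minor_mul (K : comNzRingType) (P : 'M[K]_e) (X : 'M[K]_(e, n)) f :
  minor (P *m X) f = \det P * minor X f.
Proof. by rewrite /minor -mulmx_colsub det_mulmx. Qed.

Lemma minorZ (K : comNzRingType) (a : K) (X : 'M[K]_(e, n)) f :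
  minor (a *: X) f = a ^+ e * minor X f.
Proof. by rewrite -mul_scalar_mx minor_mul det_scalar. Qed.

(** Minors on arbitrary columns are determined by those on increasing columns, by
    sorting the columns. *)
Lemma minor_sort (f : {ffun 'I_e -> 'I_n}) :
  (forall (K : comNzRingType) (X : 'M[K]_(e, n)), minor X f = 0) \/
  exists2 g, increasing g &
    exists b : bool, forall (K : comNzRingType) (X : 'M[K]_(e, n)),
      minor X f = (-1) ^+ b * minor X g.
Proof.
have [/injectiveP finj|] := boolP (injectiveb f); last first.
  move=> /injectivePn[i1 [i2 ne12 f12]]; left => K X.
  rewrite /minor -det_tr; apply: (determinant_alternate ne12) => k.
  by rewrite !mxE f12.
right; pose t := [tuple f i | i < e]; pose r (x y : 'I_n) := (x <= y)%N.
have /tuple_permP[p tp] : perm_eq (sort r t) t by rewrite perm_sort.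
have np i : nth (f i) (sort r t) i = f (p i).
  have -> : sort r t = [tuple tnth t (p i) | i < e] by rewrite {1}tp.
  by rewrite -tnth_nth tnth_mktuple tnth_mktuple.
exists [ffun i => f (p i)].
  apply/forallP => i; apply/forallP => k; apply/implyP => ik; rewrite !ffunE.
  have r_trans : transitive r by move=> x y z; exact: leq_trans.
  have r_total : total r by move=> x y; exact: leq_total.
  rewrite ltn_neqAle; apply/andP; split.
    apply: contraTneq ik => /val_inj /finj /perm_inj ->; by rewrite ltnn.
  have := @sorted_ltn_nth _ _ r_trans (f i) _ (sort_sorted r_total t) i k.
  rewrite !inE size_sort size_tuple !ltn_ord => /(_ isT isT ik).
  by rewrite np (set_nth_default (f k)) ?size_sort ?size_tuple // np.
exists (odd_perm p) => K X.
have -> : minor X [ffun i => f (p i)] = \det (col_perm p (colsub f X)).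
  by rewrite /minor; congr (\det _); apply/matrixP => i k; rewrite !mxE ffunE.
rewrite col_permE det_mulmx det_perm odd_permV mulrCA.
by rewrite -expr2 sqrr_sign mulr1.
Qed.

Lemma exists_minor_neq0 (F : fieldType) (X : 'M[F]_(e, n)) : row_free X ->
  exists2 f, increasing f & minor X f != 0.
Proof.
move=> fX; have fXT : row_full X^T by rewrite /row_full mxrank_tr.
have := fullrowsub_unit fXT; set f := fullrankfun fXT.
rewrite unitmxE unitfE -det_tr trmx_mxsub trmxK => Xf.
have {}Xf : minor X f != 0 by [].
have [h|[g gincr [b h]]] := minor_sort f; first by rewrite h eqxx in Xf.
by exists g => //; apply: contraNneq Xf => g0; rewrite h g0 mulr0.
Qed.

(** Multilinear expansion along the columns, a form of the Cauchy-Binet formula in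
    which the selected indices need not increase. *)
Lemma det_mulmx_expand (K : comNzRingType) (X : 'M[K]_(e, n)) (N : 'M[K]_(n, e)) :
  \det (X *m N) =
    \sum_(g : {ffun 'I_e -> 'I_n}) minor X g * \prod_i N (g i) i.
Proof.
rewrite -det_tr /determinant.
under eq_bigr => s _.
  under eq_bigr => i _ do rewrite !mxE.
  rewrite bigA_distr_bigA mulr_sumr.
  under eq_bigr => g _ do rewrite big_split mulrA /=.
over.
rewrite exchange_big /=; apply: eq_bigr => g _; rewrite -mulr_suml.
rewrite /minor -det_tr /determinant; congr (_ * _).
by apply: eq_bigr => s _; congr (_ * _); apply: eq_bigr => i _; rewrite !mxE.
Qed.

End Minors.

Lemma minor_mulmx (K : comNzRingType) (e n m : nat) (X : 'M[K]_(e, n))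
    (M : 'M[K]_(n, m)) f :
  minor (X *m M) f = \sum_(g : {ffun 'I_e -> 'I_n}) minor X g * \prod_i M (g i) (f i).
Proof.
rewrite /minor -mulmx_colsub det_mulmx_expand; apply: eq_bigr => g _.
by congr (_ * _); apply: eq_bigr => i _; rewrite !mxE.
Qed.

Lemma minor_map (K L : comNzRingType) (h : {rmorphism K -> L}) (e n : nat)
    (X : 'M[K]_(e, n)) f : minor (map_mx h X) f = h (minor X f).
Proof. by rewrite /minor -map_mxsub det_map_mx. Qed.

Lemma pluckerE (R : realType) (n e : nat) (X : e.-tuple 'rV[R]_n) f :
  plucker X f = minor (tuple_mx X) f.
Proof.
rewrite /plucker -det_tr; congr (\det _); apply/matrixP => i j.
by rewrite !mxE.
Qed.

(** Laplace expansion along the replaced column. When [minor X f] is nonzero, this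
    matrix has the same row space as [X], so that the minors determine that space. *)
Lemma adj_colsub (K : comNzRingType) (e n : nat) (X : 'M[K]_(e, n))
    (f : {ffun 'I_e -> 'I_n}) :
  \adj (colsub f X) *m X =
    \matrix_(i, c) minor X [ffun k => if k == i then c else f k].
Proof.
apply/matrixP => i c; rewrite !mxE /minor (expand_det_col _ i).
apply: eq_bigr => l _; rewrite !mxE ffunE eqxx mulrC; congr (_ * _).
rewrite /cofactor; congr (_ * \det _); apply/matrixP => a b.
by rewrite !mxE ffunE eq_sym (negbTE (neq_lift _ _)).
Qed.

Lemma rowbasis_inj (R : realType) (n e : nat) (X Y : 'M[R]_(e, n)) B B' (c c' : R) :
  rowbasis X B -> rowbasis Y B' -> c != 0 -> c' != 0 ->
  (forall f, increasing f -> c * minor X f = c' * minor Y f) -> B = B'.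
Proof.
move=> [fX BX] [fY BY] c0 c'0 hXY.
have {}hXY f : c * minor X f = c' * minor Y f.
  have [h|[g gincr [b h]]] := minor_sort f; first by rewrite !h !mulr0.
  by rewrite !h mulrCA hXY // mulrCA.
have [f fincr Xf] := exists_minor_neq0 fX.
have Yf : minor Y f != 0.
  apply: contraNneq Xf => Yf; have /eqP := hXY f.
  by rewrite Yf mulr0 mulf_eq0 (negbTE c0).
have eqXY : c *: (\adj (colsub f X) *m X) = c' *: (\adj (colsub f Y) *m Y).
  by apply/matrixP => i k; rewrite !adj_colsub !mxE.
have eqrow (Z : 'M[R]_(e, n)) (a : R) : a != 0 -> minor Z f != 0 ->
    (a *: (\adj (colsub f Z) *m Z) :=: Z)%MS.
  move=> a0 Zf; apply: eqmx_trans (eqmx_scale _ a0) _; apply: eqmxMfull.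
  rewrite row_full_unit unitmxE unitfE.
  have /(congr1 determinant) := mul_adj_mx (colsub f Z).
  rewrite det_mulmx det_scalar => /eqP h; apply: contraTneq h => ->.
  by rewrite mul0r eq_sym expf_eq0 (negbTE Zf) andbF.
by apply/vspaceP => v; rewrite BX BY -(eqrow X c) // eqXY (eqrow Y c').
Qed.

(** * Rational subspaces and heights *)

Section RationalMatrices.
Variables (R : realType).

Definition rational_mx (m n : nat) (M : 'M[R]_(m, n)) : Prop :=
  exists MQ : 'M[rat]_(m, n), M = map_mx ratr MQ.

Lemma rational_mxM (m n p : nat) (M : 'M[R]_(m, n)) (N : 'M[R]_(n, p)) :
  rational_mx M -> rational_mx N -> rational_mx (M *m N).
Proof. by move=> [P ->] [Q ->]; exists (P *m Q); rewrite map_mxM. Qed.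

Lemma rational_rows (m n : nat) (M : 'M[R]_(m, n)) :
  (forall i, rational_vec (row i M)) -> rational_mx M.
Proof.
move=> h; have h' (p : 'I_m * 'I_n) : exists q : rat, M p.1 p.2 = ratr q.
  by have [q qE] := h p.1 p.2; exists q; rewrite -qE mxE.
have [q qE] := boolp.choice h'.
exists (\matrix_(i, j) q (i, j)); apply/matrixP => i j.
by rewrite !mxE -qE.
Qed.

Lemma rational_mx_row (m n : nat) (M : 'M[R]_(m, n)) i :
  rational_mx M -> rational_vec (row i M).
Proof. by move=> [Q ->] j; exists (Q i j); rewrite !mxE. Qed.

Lemma denq_ratr (r : rat) : (denq r)%:~R * ratr r = (numq r)%:~R :> R.
Proof. by rewrite /ratr mulrC divfK // intr_eq0 denq_eq0. Qed.

Lemma rational_mx_clear (m n : nat) (M : 'M[R]_(m, n)) : rational_mx M ->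
  exists2 D : int, D != 0 & exists MZ : 'M[int]_(m, n), D%:~R *: M = map_mx intr MZ.
Proof.
move=> [Q ->]; pose q (p : 'I_m * 'I_n) := Q p.1 p.2.
exists (\prod_p denq (q p)).
  by apply/prodf_neq0 => p _; rewrite denq_eq0.
exists (\matrix_(i, j) (numq (q (i, j)) * \prod_(p | p != (i, j)) denq (q p))).
apply/matrixP => i j; rewrite !mxE (bigD1 (i, j)) //= !intrM.
by rewrite mulrAC -[Q i j]/(q (i, j)) denq_ratr.
Qed.

Lemma rational_sub_mx (n e : nat) (B : {vspace 'rV[R]_n}) :
  rational_subs e B -> exists2 X : 'M[R]_(e, n), rowbasis X B & rational_mx X.
Proof.
move=> [[X bX Xrat] dimB].
have sX : size X == e by rewrite -(eqnP (basis_free bX)) (span_basis bX) dimB.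
exists (tuple_mx (Tuple sX)); first exact: basis_rowbasis.
apply: rational_rows => i; rewrite rowK; apply: Xrat.
by rewrite -[X]/(tval (Tuple sX)) mem_tnth.
Qed.

Lemma rowbasis_rational (n e : nat) (X : 'M[R]_(e, n)) (B : {vspace 'rV[R]_n}) :
  rowbasis X B -> rational_mx X -> rational_subs e B.
Proof.
move=> bX ratX; split; last exact: rowbasis_dim bX.
exists [tuple row i X | i < e]; first exact: rowbasis_basis.
by move=> _ /tnthP[i ->]; rewrite tnth_mktuple; exact: rational_mx_row.
Qed.

Lemma rational_subs_img (n m e : nat) (M : 'M[R]_(n, m)) (B : {vspace 'rV[R]_n})
    (f := linfun (mulmxr M : 'rV[R]_n -> 'rV[R]_m)) :
  rational_mx M -> rational_subs e B -> (B :&: lker f = 0)%VS ->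
  rational_subs e (f @: B)%VS.
Proof.
move=> ratM /rational_sub_mx[X bX ratX] kerB.
exact: rowbasis_rational (rowbasis_img bX kerB) (rational_mxM ratX ratM).
Qed.

End RationalMatrices.

Section Height.
Variables (R : realType) (n e : nat).
Local Notation idx := {ffun 'I_e -> 'I_n}.
Implicit Types (B : {vspace 'rV[R]_n}) (X : 'M[R]_(e, n)) (Z : idx -> int).

Definition int_norm Z : R := Num.sqrt (\sum_(f | increasing f) (Z f)%:~R ^+ 2).

Lemma int_norm_ge0 Z : 0 <= int_norm Z.
Proof. exact: sqrtr_ge0. Qed.

Lemma le_int_norm Z f : increasing f -> `|(Z f)%:~R| <= int_norm Z.
Proof.
move=> fincr; rewrite -(@ler_pXn2r _ 2) ?nnegrE ?int_norm_ge0 //.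
rewrite real_normK ?num_real // sqr_sqrtr; last first.
  by apply: sumr_ge0 => g _; exact: sqr_ge0.
by rewrite (bigD1 f) //= lerDl; apply: sumr_ge0 => g _; exact: sqr_ge0.
Qed.

Definition plucker_rep B Z : Prop :=
  exists (X : 'M[R]_(e, n)) (c : R),
    [/\ rowbasis X B, c != 0 & forall f, increasing f -> (Z f)%:~R = c * minor X f].

Lemma plucker_rep_neq0 B Z : plucker_rep B Z -> exists2 f, increasing f & Z f != 0.
Proof.
move=> [X [c [[fX _] c0 ZX]]]; have [f fincr Xf] := exists_minor_neq0 fX.
by exists f => //; rewrite -(intr_eq0 R) ZX // mulf_neq0.
Qed.

Lemma gcd_neq0 B Z : plucker_rep B Z -> \big[gcdn/0%N]_(f | increasing f) `|Z f|%N != 0%N.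
Proof.
move=> /plucker_rep_neq0[f fincr Zf]; apply: contraNneq Zf => g0.
have /dvdn_biggcdP/(_ f fincr) : (0 %| \big[gcdn/0%N]_(f | increasing f) `|Z f|)%N.
  by rewrite g0.
by rewrite dvd0n absz_eq0.
Qed.

(** A primitive representative divides every integral representative: if
    [q * Z = p * Xi] with [p], [q] coprime, then [q] divides the gcd of the
    coordinates of [Xi]. *)
Lemma primitive_le B (Xi Z : idx -> int) :
  \big[gcdn/0%N]_(f | increasing f) `|Xi f|%N = 1%N ->
  plucker_rep B Xi -> plucker_rep B Z -> int_norm Xi <= int_norm Z.
Proof.
move=> Xi1 repXi repZ; have [f0 f0incr Xif0] := plucker_rep_neq0 repXi.
have [X [c [bX c0 XiX]]] := repXi; have [Y [c' [bY c'0 ZY]]] := repZ.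
have [P P0 YE] := rowbasis_change bX bY.
pose rho := c' * \det P / c.
have rho0 : rho != 0 by rewrite !mulf_neq0 ?invr_eq0.
have ZXi f : increasing f -> (Z f)%:~R = rho * (Xi f)%:~R.
  by move=> fi; rewrite ZY // YE minor_mul XiX // /rho; field.
pose r : rat := (Z f0)%:~R / (Xi f0)%:~R.
have rhoE : rho = ratr r.
  by rewrite /r fmorph_div /= !ratr_int ZXi // mulfK // intr_eq0.
have qZ f : increasing f -> denq r * Z f = numq r * Xi f.
  move=> fi; apply: (@intr_inj R);
    by rewrite !intrM ZXi // rhoE mulrA denq_ratr.
have q1 : `|denq r|%N = 1%N.
  apply/eqP; rewrite -dvdn1 -Xi1; apply/dvdn_biggcdP => f fi.
  have : (denq r %| numq r * Xi f)%Z by rewrite -qZ // dvdz_mulr.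
  rewrite Gauss_dvdzr //; rewrite /coprimez gcdzC -/(coprimez _ _).
  by rewrite /coprimez /gcdz; have := coprime_num_den r; rewrite /coprime => /eqP ->.
rewrite ler_sqrt; last by apply: sumr_ge0 => f _; exact: sqr_ge0.
apply: ler_sum => f fi; rewrite ZXi // exprMn ler_peMl ?sqr_ge0 //.
have -> : rho = (numq r)%:~R by rewrite -denq_ratr -absz_denq q1 mul1r.
rewrite -rmorphXn /= ler1z -gtz0_ge1 exprn_even_gt0 //=.
by apply: contraNneq rho0 => p0; rewrite rhoE /ratr p0 mul0r.
Qed.

(** Divide the coordinates by their gcd. *)
Lemma plucker_rep_primitive B Z : plucker_rep B Z ->
  exists2 Xi : idx -> int, \big[gcdn/0%N]_(f | increasing f) `|Xi f|%N = 1%N &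
    plucker_rep B Xi.
Proof.
move=> repZ; have := gcd_neq0 repZ; set g := \big[_/_]_(f | _) _ => g0.
have gZ f : increasing f -> (g %| Z f)%Z.
  by have /dvdn_biggcdP h := dvdnn g; move=> /h.
have [X [c [bX c0 ZX]]] := repZ.
exists (fun f => (Z f %/ g)%Z).
  set h := \big[_/_]_(f | _) _; apply/eqP; rewrite -dvdn1.
  rewrite -(@dvdn_pmul2r g) ?lt0n // mul1n; apply/dvdn_biggcdP => f fi.
  have /dvdn_biggcdP/(_ f fi) hf := dvdnn h.
  by rewrite -(divzK (gZ f fi)) abszM absz_nat dvdn_mul.
have gR : g%:~R != 0 :> R by rewrite intr_eq0.
exists X, (c / g%:~R); split => // [|f fi]; first by rewrite mulf_neq0 ?invr_eq0.
by rewrite mulrAC -ZX // -{2}(divzK (gZ f fi)) intrM mulfK.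
Qed.

End Height.

Lemma primitive_pluckerE (R : realType) (n : nat) (B : {vspace 'rV[R]_n}) Xi :
  primitive_plucker (B := B) Xi <->
  \big[gcdn/0%N]_(f | increasing f) `|Xi f|%N = 1%N /\ plucker_rep B Xi.
Proof.
split=> -[Xi1 [X [c [bX c0 XiX]]]]; split => //.
  exists (tuple_mx X), c; split => //; first exact: basis_rowbasis.
  by move=> f fi; rewrite XiX // pluckerE.
exists [tuple row i X | i < \dim B], c; split => //; first exact: rowbasis_basis.
move=> f fi; rewrite XiX // pluckerE; congr (_ * minor _ _).
by apply/row_matrixP => i; rewrite rowK tnth_mktuple.
Qed.

Section HeightBounds.
Variables (R : realType) (n e : nat).
Local Notation idx := {ffun 'I_e -> 'I_n}.
Implicit Types (B : {vspace 'rV[R]_n}) (Z : idx -> int).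

Lemma height_le_norm B Z : plucker_rep B Z -> height B <= int_norm R Z.
Proof.
move=> repZ; have [X [_ [/rowbasis_dim dimB _ _]]] := repZ; subst e.
rewrite /height; case: xgetP => [_ _ [Xi /primitive_pluckerE[Xi1 repXi] ->]|_].
  exact: primitive_le repXi repZ.
exact: int_norm_ge0.
Qed.

Lemma height_rep B : rational_subs e B ->
  exists Z : idx -> int, [/\ plucker_rep B Z, height B = int_norm R Z & 1 <= height B].
Proof.
move=> ratB; have [X bX ratX] := rational_sub_mx ratB.
have [D D0 [XZ XE]] := rational_mx_clear ratX.
have dimB := rowbasis_dim bX; subst e.
have repXZ : plucker_rep B (minor XZ).
  exists X, (D%:~R ^+ \dim B); split => //; first by rewrite expf_neq0 ?intr_eq0.
  by move=> f _; rewrite -minorZ XE (minor_map intr).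
have [Xi0 Xi01 repXi0] := plucker_rep_primitive repXZ.
have [Xi [repXi hXi]] : exists Xi : {ffun 'I_(\dim B) -> 'I_n} -> int,
    plucker_rep B Xi /\ height B = int_norm R Xi.
  rewrite /height; case: xgetP => [_ _ [Xi /primitive_pluckerE[_ repXi] ->]|].
    by exists Xi.
  move=> /(_ (int_norm R Xi0)) []; exists Xi0 => //.
  exact/primitive_pluckerE.
exists Xi; split => //; rewrite hXi.
have [f fi Xif] := plucker_rep_neq0 repXi.
apply: le_trans (le_int_norm R _ fi).
by rewrite -intr_norm ler1z -gtz0_ge1 normr_gt0.
Qed.

Lemma height_ge1 B : rational_subs e B -> 1 <= height B.
Proof. by case/height_rep => Z []. Qed.

Lemma plucker_rep_inj B B' Z : plucker_rep B Z -> plucker_rep B' Z -> B = B'.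
Proof.
move=> [X [c [bX c0 ZX]]] [Y [c' [bY c'0 ZY]]].
by apply: (rowbasis_inj bX bY c0 c'0) => f fi; rewrite -ZX // -ZY.
Qed.

(** Northcott's property: [B] is determined by its primitive Pluecker coordinates,
    which are integers bounded by the height. *)
Lemma finite_height_le (K : R) :
  finite_set [set B : {vspace 'rV[R]_n} | rational_subs e B /\ height B <= K].
Proof.
pose N := Num.bound `|K|.
pose decode (c : {ffun idx -> 'I_(N.*2.+1)}) : idx -> int := fun f => (c f)%:Z - N%:Z.
pose F c : {vspace 'rV[R]_n} :=
  xget 0%VS [set B | exists2 Z, plucker_rep B Z &
    forall f, increasing f -> Z f = decode c f].
apply: sub_finite_set (finite_image F (@finite_finset _ [set: {ffun idx -> 'I_(N.*2.+1)}])).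
move=> B [ratB hB]; have [Z [repZ hZ _]] := height_rep ratB.
exists [ffun f => inord `|Z f + N%:Z|] => //.
have eqZ f : increasing f -> Z f = decode [ffun f => inord `|Z f + N%:Z|] f.
  move=> fi; rewrite /decode ffunE.
  have : `|Z f| < N%:Z.
    rewrite -(ltr_int R) intr_norm; apply: le_lt_trans (le_int_norm R Z fi) _.
    rewrite -hZ; apply: le_lt_trans hB _.
    apply: le_lt_trans (ler_norm _) _; rewrite -pmulrn.
    exact: archi_boundP (normr_ge0 K).
  rewrite ltr_norml => /andP[ZN NZ].
  have ZN0 : 0 <= Z f + N%:Z by rewrite -lerBlDr sub0r ltW.
  rewrite inordK; first by rewrite gez0_abs // addrK.
  rewrite ltnS -lez_nat gez0_abs // -addnn PoszD lerD2r; exact: ltW.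
apply: xget_subset1; first by exists Z.
move=> B1 B2 [Z1 rep1 e1] [Z2 rep2 e2]; apply: (plucker_rep_inj rep1).
have [Y [c [bY c0 ZY]]] := rep2; exists Y, c; split => // f fi.
by rewrite e1 // -e2 // ZY.
Qed.

End HeightBounds.

(** Clearing the denominators of [M], the minors of [X *m M] are fixed integral linear
    combinations of the minors of [X]. *)
Lemma height_img (R : realType) (n m e : nat) (M : 'M[R]_(n, m))
    (f := linfun (mulmxr M : 'rV[R]_n -> 'rV[R]_m)) :
  rational_mx M -> exists2 C : R, 0 <= C & forall B : {vspace 'rV[R]_n},
    rational_subs e B -> (B :&: lker f = 0)%VS -> height (f @: B) <= C * height B.
Proof.
move=> /rational_mx_clear[D D0 [MZ ME]].
pose coef (h : {ffun 'I_e -> 'I_m}) : R :=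
  \sum_(g : {ffun 'I_e -> 'I_n}) `|\prod_i (MZ (g i) (h i))%:~R|.
exists (Num.sqrt (\sum_(h | increasing h) coef h ^+ 2)); first exact: sqrtr_ge0.
move=> B ratB kerB; have [Z [[X [c [bX c0 ZX]]] -> _]] := height_rep ratB.
have {}ZX : exists2 W : {ffun 'I_e -> 'I_n} -> int,
    forall g, (W g)%:~R = c * minor X g & forall g, `|(W g)%:~R| <= int_norm R Z.
  have h g : exists w : int, w%:~R = c * minor X g /\ `|w%:~R| <= int_norm R Z.
    have [h|[g' g'i [b h]]] := minor_sort g.
      by exists 0; rewrite h mulr0 normr0 int_norm_ge0.
    exists ((-1) ^+ b * Z g'); rewrite h intrM ZX // mulrCA intr_sign; split => //.
    by rewrite mulrCA normrMsign -ZX // le_int_norm.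
  have [W hW] := boolp.choice h; exists W => g; by have [] := hW g.
have [W WE Wle] := ZX.
pose V (h : {ffun 'I_e -> 'I_m}) : int := \sum_g W g * \prod_i MZ (g i) (h i).
have repV : plucker_rep (f @: B) V.
  exists (X *m M), (c * D%:~R ^+ e); split.
  - exact: rowbasis_img.
  - by rewrite mulf_neq0 // expf_neq0 // intr_eq0.
  move=> h _; rewrite -mulrA -minorZ scalemxAr ME minor_mulmx /V rmorph_sum mulr_sumr.
  apply: eq_bigr => g _; rewrite rmorphM /= WE rmorph_prod mulrA; congr (_ * _).
  by apply: eq_bigr => i _; rewrite mxE.
apply: le_trans (height_le_norm repV) _.
have sum0 : 0 <= \sum_(h | increasing h) coef h ^+ 2.
  by apply: sumr_ge0 => h _; exact: sqr_ge0.
rewrite -(@ler_pXn2r _ 2) ?nnegrE ?int_norm_ge0 ?mulr_ge0 ?sqrtr_ge0 ?int_norm_ge0 //.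
rewrite exprMn (sqr_sqrtr sum0) [leLHS]sqr_sqrtr;
  last by apply: sumr_ge0 => h _; exact: sqr_ge0.
rewrite mulr_suml; apply: ler_sum => h _; rewrite -exprMn -(real_normK (num_real _)).
rewrite ler_pXn2r ?nnegrE ?mulr_ge0 ?int_norm_ge0 //; last by apply: sumr_ge0.
rewrite rmorph_sum (le_trans (ler_norm_sum _ _ _)) // mulr_suml; apply: ler_sum => g _.
by rewrite rmorphM /= normrM mulrC rmorph_prod ler_wpM2l.
Qed.

(** * Comparison of exponents *)

Lemma finite_pos_lb (R : realType) (T : choiceType) (S : set T) (f : T -> R) :
  finite_set S -> (forall x, S x -> 0 < f x) ->
  exists2 delta, 0 < delta & forall x, S x -> delta <= f x.
Proof.
move=> /finite_seqP[s ->]; elim: s => [|x s IH] pos.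
  by exists 1 => // x; rewrite /= in_nil.
have [|delta d0 dle] := IH.
  by move=> y ys; apply: pos; rewrite /= inE (ys : is_true (y \in s)) orbT.
exists (Num.min delta (f x)).
  by rewrite lt_min d0 pos //= inE eqxx.
move=> y; rewrite /= inE => /orP[/eqP->|/dle]; first by rewrite ge_min lexx orbT.
by rewrite ge_min => ->.
Qed.

Lemma powR_large (R : realType) (a c : R) : 0 < a ->
  exists K : R, forall h, K <= h -> c < h `^ a.
Proof.
move=> a0; exists ((1 + `|c|) `^ a^-1) => h Kh.
have c0 : 0 <= 1 + `|c| by rewrite addr_ge0.
apply: (@lt_le_trans _ _ (1 + `|c|)).
  by rewrite (le_lt_trans (ler_norm c)) // ltrDr.
have -> : 1 + `|c| = ((1 + `|c|) `^ a^-1) `^ a.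
  by rewrite -powRrM mulVf ?powRr1 // lt0r_neq0.
apply: (ge0_ler_powR _ _ _ Kh); rewrite ?ltW ?nnegrE ?powR_ge0 //.
exact: le_trans (powR_ge0 _ _) Kh.
Qed.

Lemma powR_absorb (R : realType) (c C h b b' : R) : 0 < C -> 0 < h ->
  c * C `^ b' <= h `^ (b - b') -> c * h `^ (- b) <= (C * h) `^ (- b').
Proof.
move=> C0 h0 H; rewrite !powRN ler_pdivrMr ?powR_gt0 // mulrC.
rewrite ler_pdivlMr; last by rewrite powR_gt0 // mulr_gt0.
rewrite (powRM _ (ltW C0) (ltW h0)) mulrA -{1}(subrK b' b) powRD;
  last by rewrite lt0r_neq0 ?implybT.
by apply: ler_wpM2r => //; exact: powR_ge0.
Qed.

Lemma powRN_anti (R : realType) (x y b : R) : 0 < x -> x <= y -> 0 <= b ->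
  y `^ (- b) <= x `^ (- b).
Proof.
move=> x0 xy b0; have y0 := lt_le_trans x0 xy.
rewrite !powRN lef_pV2 ?posrE ?powR_gt0 //.
by apply: ge0_ler_powR => //; rewrite nnegrE ltW.
Qed.

Lemma le_sum_term (R : realType) (T : finType) (F : T -> R) t :
  (forall u, 0 <= F u) -> F t <= \sum_u F u.
Proof. by move=> F0; rewrite (bigD1 t) //= lerDl; apply: sumr_ge0. Qed.

Section ExponentComparison.
Variables (R : realType) (n m e j : nat) (T : finType).
Variables (M : T -> 'M[R]_(n, m)) (N : 'M[R]_(m, n)).
Variables (A : {vspace 'rV[R]_n}) (A' : {vspace 'rV[R]_m}).
Let f t := linfun (mulmxr (M t) : 'rV[R]_n -> 'rV[R]_m).
Hypothesis ratM : forall t, rational_mx (M t).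
Hypothesis MN : forall t x, x \in A -> x *m M t *m N = x.
Hypothesis imgA : forall t, (f t @: A)%VS = A'.
Hypothesis injB : forall B, rational_subs e B -> exists t, (B :&: lker (f t) = 0)%VS.
Hypotheses (j0 : (0 < j)%N) (jA : (j <= \dim A)%N) (je : (j <= e)%N).
Hypothesis irrA' : forall B, rational_subs e B -> (\dim (A' :&: B) < j)%N.

Lemma dim_imgA (t : T) : \dim A' = \dim A.
Proof.
rewrite -(imgA t) limg_dim_eq //; apply/eqP; rewrite -subv0; apply/subvP => x.
rewrite memv_cap memv_ker lfunE /= => /andP[xA /eqP xM].
by rewrite memv0 -(MN t xA) xM mul0mx.
Qed.

(** The map [B |-> f t @: B], with [t] chosen so as to be injective on [B], increases
    heights and sines of angles by bounded factors at most, which the gap between [b] and [b']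
    absorbs once [height B] is large. It could fail to be injective on the set of
    approximations, but if only finitely many [B'] approximated [A'], the sines of
    their angles with [A'], nonzero by irrationality, would be bounded below, whereas
    those for [f t @: B] tend to [0] as [height B] grows. *)
Lemma approximations_transfer (b b' : R) : 0 < b' -> b' < b ->
  infinite_set [set B : {vspace 'rV[R]_n} | rational_subs e B /\
                  psi_idx j A B <= height B `^ (- b)] ->
  infinite_set [set B : {vspace 'rV[R]_m} | rational_subs e B /\
                  psi_idx j A' B <= height B `^ (- b')].
Proof.
move=> b'0 b'b infS finS'.
set S := [set B | _] in infS; set S' := [set B | _] in finS'.
have b0 : 0 < b := lt_trans b'0 b'b.
have [B0 [/injB[t0 _] _]] : S !=set0 by exact/infinite_setN0.
have [delta d0 dle] : exists2 delta : R, 0 < delta &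
    forall B, S' B -> delta <= psi_idx j A' B.
  apply: (finite_pos_lb finS') => B [ratB _].
  rewrite lt_def psi_idx_ge0 andbT; apply/negP => /eqP psi0.
  have jA' : (j <= \dim A')%N by rewrite (dim_imgA t0).
  have jB : (j <= \dim B)%N by case: ratB => _ ->.
  by have := irrA' ratB; rewrite ltnNge (psi_idx_eq0 jA' jB psi0).
pose C1 : R := \sum_t (2 * j%:R ^+ 2 * (1 + mxbound (M t) * mxbound N)).
have C1pos t : 0 <= 2 * j%:R ^+ 2 * (1 + mxbound (M t) * mxbound N).
  by rewrite mulr_ge0 ?mulr_ge0 ?exprn_ge0 ?addr_ge0 ?mulr_ge0 ?mxbound_ge0.
have C1ge0 : 0 <= C1 by apply: sumr_ge0 => t _; exact: C1pos.
have psiC1 t B : rational_subs e B -> (B :&: lker (f t) = 0)%VS ->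
    psi_idx j A' (f t @: B) <= C1 * psi_idx j A B.
  move=> [_ dimB] kerB; rewrite -(imgA t).
  have jB : (j <= \dim B)%N by rewrite dimB.
  apply: le_trans (psi_idx_img j0 jA jB (@MN t) kerB) _.
  exact: ler_wpM2r (psi_idx_ge0 _ _ _) _ _ (le_sum_term t C1pos).
have heightC t : exists C : R, 0 <= C /\ forall B, rational_subs e B ->
    (B :&: lker (f t) = 0)%VS -> height (f t @: B) <= C * height B.
  have [C C0 CP] := height_img e (ratM t).
  by exists C; split; [exact: C0|exact: CP].
have [C2t C2P] := boolp.choice heightC.
pose C2 : R := 1 + \sum_t C2t t.
have C2ge1 : 1 <= C2 by rewrite lerDl; apply: sumr_ge0 => t _; have [] := C2P t.
have C2gt0 : 0 < C2 by exact: lt_le_trans C2ge1.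
have heightC2 t B : rational_subs e B -> (B :&: lker (f t) = 0)%VS ->
    height (f t @: B) <= C2 * height B.
  move=> ratB kerB; have [_ h] := C2P t; apply: le_trans (h B ratB kerB) _.
  apply: ler_wpM2r; first exact: le_trans (height_ge1 ratB).
  apply: (@le_trans _ _ (\sum_u C2t u)); last by rewrite lerDr.
  by apply: le_sum_term => u; have [] := C2P u.
have [K1 K1P] := powR_large (C1 / delta) b0.
have bb'0 : 0 < b - b' by rewrite subr_gt0.
have [K2 K2P] := powR_large (C1 * C2 `^ b') bb'0.
have [B [ratB psiB] KB] : exists2 B, S B & Num.max K1 K2 < height B.
  apply: contrapT => noB; apply: infS.
  apply: sub_finite_set (finite_height_le n e (Num.max K1 K2)) => B SB.
  split; first by case: SB.
  by rewrite leNgt; apply/negP => KB; apply: noB; exists B.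
move: KB; rewrite gt_max => /andP[/ltW/K1P hK1 /ltW/K2P hK2].
have h0 : 0 < height B by exact: lt_le_trans (height_ge1 ratB).
have [t kerB] := injB ratB.
have ratB' := rational_subs_img (ratM t) ratB kerB.
have psi_small : psi_idx j A' (f t @: B) <= C1 * height B `^ (- b).
  by apply: le_trans (psiC1 t B ratB kerB) _; exact: ler_wpM2l.
have SB' : S' (f t @: B)%VS.
  split; first exact: ratB'.
  apply: le_trans psi_small _.
  have h0' : 0 < height (f t @: B) by exact: lt_le_trans (height_ge1 ratB').
  apply: (@le_trans _ _ ((C2 * height B) `^ (- b'))).
    exact: powR_absorb C2gt0 h0 (ltW hK2).
  exact: powRN_anti h0' (heightC2 t B ratB kerB) (ltW b'0).
have := dle _ SB'; apply/negP; rewrite -ltNge; apply: le_lt_trans psi_small _.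
by rewrite powRN (ltr_pdivrMr _ _ (powR_gt0 b h0)) mulrC -(ltr_pdivrMr _ _ d0).
Qed.

Lemma mu_exp_le : (mu_exp A e j <= mu_exp A' e j)%E.
Proof.
apply: ge_ereal_sup => _ [b [b0 infS] <-].
apply/lee_subgt0Pr => eps eps0; pose b' := Num.max (b / 2) (b - eps).
have b'0 : 0 < b' by rewrite lt_max divr_gt0.
have b'b : b' < b by rewrite gt_max gtr_pMr // invf_lt1 // ltr1n /= gtrBl.
apply: (@le_trans _ _ b'%:E); first by rewrite -EFinB lee_fin le_max lexx orbT.
apply: ereal_sup_ubound; exists b'; last by []; split; first by [].
exact: approximations_transfer infS.
Qed.


End ExponentComparison.

(** * Rational maps extending phi *)

Section GenericProjection.
Variables (R : realType) (n k : nat) (M0 : 'M[R]_(n, k)) (N0 : 'M[R]_(k, n)).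

(** With [Q = 1 - M0 *m N0], the words [s] list the elementary matrices to be added to a
    matrix [G], starting from [0], in [M0 + Q *m G]. *)
Definition word_mx (s : seq ('I_n * 'I_k)) : 'M[R]_(n, k) :=
  \sum_(p <- s) delta_mx p.1 p.2.

Definition perturbed_mx (s : seq ('I_n * 'I_k)) : 'M[R]_(n, k) :=
  M0 + (1%:M - M0 *m N0) *m word_mx s.

Local Notation ker s := (lker (linfun (mulmxr (perturbed_mx s) : 'rV[R]_n -> 'rV[R]_k))).

Lemma perturbed_mx_cons p s :
  perturbed_mx (p :: s) = perturbed_mx s + (1%:M - M0 *m N0) *m delta_mx p.1 p.2.
Proof. by rewrite /perturbed_mx /word_mx big_cons mulmxDr addrCA addrC. Qed.

Lemma perturbed_mx_fix s (x : 'rV[R]_n) : x *m M0 *m N0 = x -> x *m perturbed_mx s = x *m M0.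
Proof.
by move=> xMN; rewrite mulmxDr mulmxA mulmxBr mulmx1 mulmxA xMN subrr mul0mx addr0.
Qed.

Lemma rational_perturbed_mx s :
  rational_mx M0 -> rational_mx N0 -> rational_mx (perturbed_mx s).
Proof.
move=> [P PE] [Q QE].
exists (P + (1%:M - P *m Q) *m (\sum_(p <- s) delta_mx p.1 p.2 : 'M[rat]_(n, k))).
rewrite /perturbed_mx map_mxD map_mxM map_mxB map_mxM map_mx1 -PE -QE; congr (_ + _ *m _).
rewrite raddf_sum; apply: eq_bigr => p _; exact/esym/map_delta_mx.
Qed.

(** Let [y != 0] in [B] be killed by [perturbed_mx s]. If [y *m (1 - M0 *m N0)] were
    [0], then so would be [y *m M0], and also [y = y *m M0 *m N0]. Hence
    [y *m (1 - M0 *m N0)] has a nonzero coordinate, at [p] say. As the image of [B] is not everything, some basis vector, at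
    [q] say, lies outside it. Adding the coordinate [p] of [x *m (1 - M0 *m N0)] times
    this vector to the image of [x] rescues [y] from the kernel, and puts no new vector
    of [B] into it. *)
Lemma perturb_ker (B : {vspace 'rV[R]_n}) s : (\dim B <= k)%N ->
  (0 < \dim (B :&: ker s))%N ->
  exists p, (\dim (B :&: ker (p :: s)) < \dim (B :&: ker s))%N.
Proof.
move=> Bk ker0; set f := linfun (mulmxr (perturbed_mx s) : 'rV[R]_n -> 'rV[R]_k).
have fE x : f x = x *m perturbed_mx s by rewrite lfunE.
set Q := 1%:M - M0 *m N0.
have [y [yB y0 yM]] : exists y, [/\ y \in B, y != 0 & y *m perturbed_mx s = 0].
  exists (vpick (B :&: lker f)%VS); have := memv_pick (B :&: lker f)%VS.
  rewrite memv_cap memv_ker fE => /andP[yB /eqP yM]; split => //.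
  by rewrite vpick0 -dimv_eq0 -lt0n.
have yQ : y *m Q != 0.
  apply: contraNneq y0 => yQ; have : y *m M0 = 0.
    by move: yM; rewrite mulmxDr mulmxA yQ mul0mx addr0.
  move=> yM0; rewrite -[y]mulmx1 -(subrK (M0 *m N0) 1%:M) mulmxDr.
  by rewrite yQ mulmxA yM0 mul0mx addr0.
have [p yQp] : exists p, (y *m Q) 0 p != 0.
  by have /rV0Pn[p] := yQ; exists p.
have [q qB] : exists q, (delta_mx 0 q : 'rV[R]_k) \notin (f @: B)%VS.
  apply/existsP; rewrite -negb_forall; apply/negP => /forallP h.
  have : (fullv <= f @: B)%VS.
    apply/subvP => v _; rewrite (row_sum_delta v); apply: memv_suml => i _.
    exact: memvZ.
  move/dimvS; rewrite dimvf /dim /= mul1n leqNgt => /negP; apply.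
  by apply: leq_trans Bk; rewrite -(limg_ker_dim f B) -[X in (X < _)%N]add0n ltn_add2r.
exists (p, q); have MpqE x :
    x *m perturbed_mx ((p, q) :: s) = f x + (x *m Q) 0 p *: delta_mx 0 q.
  rewrite perturbed_mx_cons mulmxDr fE mulmxA; congr (_ + _).
  rewrite {1}(row_sum_delta (x *m Q)) mulmx_suml (bigD1 p) //= -scalemxAl.
  rewrite mul_delta_mx big1 ?addr0 // => i ip.
  by rewrite -scalemxAl mul_delta_mx_0 ?scaler0.
have sub : (B :&: ker ((p, q) :: s) <= B :&: ker s)%VS.
  apply/subvP => x; rewrite !memv_cap !memv_ker => /andP[xB].
  rewrite lfunE /= MpqE => /eqP xM; rewrite xB /=.
  have [xQ|xQ] := eqVneq ((x *m Q) 0 p) 0.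
    by rewrite -/f -xM xQ scale0r addr0.
  case/negP: qB; rewrite -[delta_mx 0 q](scalerK xQ) memvZ //.
  have -> : (x *m Q) 0 p *: delta_mx 0 q = - f x by apply/eqP; rewrite -addr_eq0 addrC xM.
  by rewrite memvN memv_img.
rewrite ltnNge; apply/negP => le; have : (B :&: ker ((p, q) :: s) == B :&: ker s)%VS.
  by rewrite eqEdim sub.
move=> /eqP /vspaceP /(_ y); rewrite !memv_cap !memv_ker !lfunE /= MpqE.
rewrite fE yM eqxx yB /= add0r.
move=> /eqP /(congr1 (fun v : 'rV_k => v 0 q)); rewrite !mxE !eqxx mulr1 => h.
by rewrite mxE h eqxx in yQp.
Qed.

(** Words of length at most [e] suffice, and there are finitely many of them: this is
    what makes the constants uniform in [B]. *)
Lemma exists_perturbed_inj (B : {vspace 'rV[R]_n}) e : \dim B = e -> (e <= k)%N ->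
  exists s : e.-bseq ('I_n * 'I_k), (B :&: ker s = 0)%VS.
Proof.
move=> dimB ek.
have h r : exists2 s, (size s <= r)%N & (\dim (B :&: ker s) <= e - r)%N.
  elim: r => [|r [s sr dr]].
    by exists [::]; rewrite // subn0 -dimB dimvS // capvSl.
  have [ker0|ker0] := posnP (\dim (B :&: ker s)).
    by exists s; [exact: leqW|rewrite ker0].
  have [|p dp] := perturb_ker _ ker0; first by rewrite dimB.
  exists (p :: s) => //; rewrite subnS -ltnS (leq_trans dp) //.
  by rewrite (leq_trans dr) // leqSpred.
have [s se] := h e; rewrite subnn leqn0 dimv_eq0 => /eqP kers.
by exists (Bseq se).
Qed.

End GenericProjection.

(** In rational coordinates: if the rows of [X] are a rational basis of [F] and those of
    [G] their images, then [M0 = X^+ G] and [N0 = G^-1 X], where [X^+] is a right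
    inverse of [X]. *)
Lemma rational_extension (R : realType) (n k : nat) (F : {vspace 'rV[R]_n})
    (phi : 'Hom(subvs_of F, 'rV[R]_k)) :
  rational_subs k F -> rational_iso phi ->
  exists (M0 : 'M[R]_(n, k)) (N0 : 'M[R]_(k, n)),
    [/\ rational_mx M0 /\ rational_mx N0, N0 *m M0 = 1%:M,
        forall x, x \in F -> x *m M0 *m N0 = x, forall u : 'rV_k, u *m N0 \in F &
        forall v : subvs_of F, phi v = vsval v *m M0].
Proof.
move=> /rational_sub_mx[X bX ratX] [/bij_inj phi_inj phi_rat]; have [fX FX] := bX.
have XF i : row i X \in F by rewrite FX row_sub.
pose b i := vsproj F (row i X).
have bE i : vsval (b i) = row i X by rewrite vsprojK.
have [GQ GE] : rational_mx (\matrix_i phi (b i)).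
  apply: rational_rows => i; rewrite rowK; apply: phi_rat; rewrite bE.
  exact: rational_mx_row.
set G := \matrix_i phi (b i) in GE.
have GuE (u : 'rV_k) : u *m G = phi (\sum_i u 0 i *: b i).
  rewrite linear_sum mulmx_sum_row; apply: eq_bigr => i _.
  by rewrite linearZ /= rowK.
have XuE (u : 'rV_k) : u *m X = vsval (\sum_i u 0 i *: b i).
  rewrite linear_sum mulmx_sum_row; apply: eq_bigr => i _.
  by rewrite linearZ /= bE.
have fG : row_free G.
  apply: inj_row_free => u; rewrite GuE => u0.
  apply: (row_free_inj fX); rewrite /= mul0mx XuE.
  have -> : \sum_i u 0 i *: b i = 0 by apply: phi_inj; rewrite u0 linear0.
  by rewrite linear0.
have [XQ XE] := ratX.
have fXQ : row_free XQ by rewrite -(row_free_map (ratr : {rmorphism rat -> R})) -XE.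
have uGQ : GQ \in unitmx.
  by rewrite -row_free_unit -(row_free_map (ratr : {rmorphism rat -> R})) -GE.
exists (map_mx ratr (pinvmx XQ *m GQ)), (map_mx ratr (invmx GQ *m XQ)).
have XM : X *m map_mx ratr (pinvmx XQ *m GQ) = G.
  by rewrite XE -map_mxM mulmxA mulmxVp // mul1mx GE.
have GN : G *m map_mx ratr (invmx GQ *m XQ) = X.
  by rewrite GE -map_mxM mulmxA mulmxV // mul1mx XE.
split.
- by split; [exists (pinvmx XQ *m GQ)|exists (invmx GQ *m XQ)].
- rewrite -map_mxM mulmxA -(mulmxA (invmx GQ)) mulmxVp // mulmx1 mulVmx //.
  exact: map_mx1.
- by move=> x; rewrite FX => /submxP[u ->]; rewrite -(mulmxA u) XM -mulmxA GN.
- move=> u; rewrite FX map_mxM -XE mulmxA; exact: submxMl.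
move=> v; have : vsval v \in F by exact: subvsP.
rewrite FX => /submxP[u vE]; rewrite vE -mulmxA XM GuE.
by congr (phi _); apply: val_inj; rewrite /= -XuE -vE.
Qed.

Lemma iso_image_mx (R : realType) (n k : nat) (F A : {vspace 'rV[R]_n})
    (phi : 'Hom(subvs_of F, 'rV[R]_k)) (M : 'M[R]_(n, k)) : (A <= F)%VS ->
  (forall v : subvs_of F, phi v = vsval v *m M) ->
  iso_image phi A = (linfun (mulmxr M : 'rV[R]_n -> 'rV[R]_k) @: A)%VS.
Proof.
move=> AF phiE; apply/vspaceP => w; apply/memv_imgP/memv_imgP => -[v].
  rewrite -memv_preim lfunE /= => vA ->; exists (vsval v) => //.
  by rewrite lfunE phiE.
move=> vA ->; exists (vsproj F v); last by rewrite phiE lfunE vsprojK // (subvP AF).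
by rewrite -memv_preim lfunE /= vsprojK // (subvP AF).
Qed.

Theorem mainTheorem7 (R : realType) (n k d e j : nat)
  (hn : (2 <= n)%N) (hk : (2 <= k <= n)%N)
  (hd : (1 <= d <= k.-1)%N) (he : (1 <= e <= k.-1)%N) (hde : (d + e <= k)%N)
  (hj : (1 <= j <= minn d e)%N)
  (A : {vspace 'rV[R]_n}) (hA : \dim A = d)
  (F : {vspace 'rV[R]_n}) (hF : rational_subs k F) (hAF : (A <= F)%VS)
  (phi : 'Hom(subvs_of F, 'rV[R]_k)) (hphi : rational_iso phi)
  (hirr : forall B' : {vspace 'rV[R]_n}, rational_subs e B' ->
    (B' <= F)%VS -> (\dim (A :&: B') < j)%N) :
  [/\ irrational_subs d e j A,
      irrational_subs d e j (iso_image phi A) &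
      mu_exp A e j = mu_exp (iso_image phi A) e j].
Proof.
have [M0 [N0 [[ratM0 ratN0] NM MN NF phiE]]] := rational_extension hF hphi.
have ek : (e <= k)%N by rewrite (leq_trans _ hde) // leq_addl.
move: hj; rewrite leq_min => /andP[j0 /andP[jd je]].
have AMN x : x \in A -> x *m M0 *m N0 = x by move=> xA; rewrite MN // (subvP hAF).
rewrite (iso_image_mx hAF phiE).
set f0 := linfun (mulmxr M0 : 'rV[R]_n -> 'rV[R]_k).
pose g0 := linfun (mulmxr N0 : 'rV[R]_k -> 'rV[R]_n).
have f0E x : f0 x = x *m M0 by rewrite lfunE.
have g0E x : g0 x = x *m N0 by rewrite lfunE.
have kerA : (A :&: lker f0 = 0)%VS.
  apply/eqP; rewrite -subv0; apply/subvP => x; rewrite memv_cap memv_ker f0E.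
  by case/andP => xA /eqP xM; rewrite memv0 -(AMN x) // xM mul0mx.
have kerg0 (B : {vspace 'rV[R]_k}) : (B :&: lker g0 = 0)%VS.
  apply/eqP; rewrite -subv0; apply/subvP => x; rewrite memv_cap memv_ker g0E.
  by case/andP => _ /eqP xN; rewrite memv0 -[x]mulmx1 -NM mulmxA xN mul0mx.
pose M (s : e.-bseq ('I_n * 'I_k)) := perturbed_mx M0 N0 s.
pose f s := linfun (mulmxr (M s) : 'rV[R]_n -> 'rV[R]_k).
have ratM s : rational_mx (M s) by exact: rational_perturbed_mx.
have AM s x : x \in A -> x *m M s = x *m M0.
  by move=> xA; apply: perturbed_mx_fix; exact: AMN.
have injB B : rational_subs e B -> exists s, (B :&: lker (f s) = 0)%VS.
  by move=> [_ dimB]; exact: exists_perturbed_inj.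
have imgM s : (f s @: A = f0 @: A)%VS.
  by apply: eq_in_limg => x xA; rewrite f0E lfunE /= AM.
have imgN : (g0 @: (f0 @: A) = A)%VS.
  rewrite -limg_comp -[RHS]lim1g; apply: eq_in_limg => x xA.
  by rewrite !lfunE /= g0E f0E AMN // id_lfunE.
(* A and B meet inside the rational subspace g0 (f s B) of F, since g0 \o f s fixes A *)
have irrA B : rational_subs e B -> (\dim (A :&: B) < j)%N.
  move=> ratB; have [s kerB] := injB B ratB.
  have ratB' : rational_subs e (g0 @: (f s @: B))%VS.
    by do ?apply: rational_subs_img.
  apply: leq_ltn_trans (hirr _ ratB' _); last first.
    by apply/subvP => _ /memv_imgP[u _ ->]; rewrite g0E NF.
  apply/dimvS/subvP => x; rewrite !memv_cap => /andP[xA xB]; rewrite xA /=.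
  have -> : x = g0 (f s x) by rewrite g0E lfunE /= AM // AMN.
  by do 2 apply: memv_img.
have irrfA B : rational_subs e B -> (\dim (f0 @: A :&: B) < j)%N.
  move=> ratB; rewrite -(limg_dim_eq (kerg0 _)).
  have ratB' : rational_subs e (g0 @: B)%VS by exact: rational_subs_img.
  apply: leq_ltn_trans (irrA _ ratB'); apply: dimvS.
  by rewrite (subv_trans (limg_cap _ _ _)) // imgN.
have dimfA : \dim (f0 @: A) = d by rewrite limg_dim_eq.
split; [by split|by split|apply/eqP; rewrite eq_le; apply/andP; split].
  apply: (@mu_exp_le _ _ _ _ _ _ M N0) => //; last by rewrite hA.
  by move=> s x xA; rewrite AM // AMN.
apply: (@mu_exp_le _ _ _ _ _ unit (fun=> N0) M0) => //.
- by move=> _ _ /memv_imgP[x xA ->]; rewrite f0E AMN.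
- by rewrite dimfA.
Qed.
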